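(* Let $T$ be a weakly quasi-o-minimal theory and let $<$ be a $0$-definable linear order on $\mathfrak C$. Consider the conditions: (NS) $T$ does not have simple semiintervals; (SH) $T$ admits a definable family of semiintervals of $(\mathfrak C,<)$ that contains a shift. (a) If $T$ satisfies (NS), then it also satisfies (SH). (b) If $T$ is small or weakly o-minimal and satisfies (SH), then it also satisfies (NS).
   Context: $T$ is a complete one-sorted first-order theory with monster model $\mathfrak C$; parameter sets are small. $T$ is small if $S_n(T)$ is countable for all $n$. $T$ is weakly quasi-o-minimal if there is a $0$-definable linear order $<$ on $\mathfrak C$ such that every parametrically definable subset of $\mathfrak C$ is a finite Boolean combination of $0$-definable sets and $<$-convex sets (this does not depend on the choice of the $0$-definable linear order); $T$ is weakly o-minimal (with respect to $<$) if every parametrically definable subset of $\mathfrak C$ is a finite union of $<$-convex sets. Semiintervals and shifts: a semiinterval of a linear order $(D,<)$ is a convex set $S\subseteq D$ having a minimum. A definable family of semiintervals of a definable order $(D,<)$ is a family $\mathcal S=(S_x\mid x\in D)$ where each $S_x$ is a semiinterval of $D$ with $\min S_x=x$ and for some formula $S(x,y)$ with parameters $S_a=S(a,\mathfrak C)$ for all $a\in D$. Powers: $S_x^1=S_x$ and $S_x^{n+1}=\bigcup_{t\in S_x^n}S_t$. $S_a$ is an $\mathcal S$-shift if the sequence $(S_a^n\mid n\in\mathbb N)$ is strictly increasing with respect to $\subset$ (equivalently, not eventually constant); $\mathcal S$ contains a shift if some $S_a$ is an $\mathcal S$-shift. Simple semiintervals: for $p\in S(A)$, $p(\mathfrak C)$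 is its set of realizations; $X\subseteq p(\mathfrak C)^n$ is relatively $B$-definable if $X=\phi(\mathfrak C)\cap p(\mathfrak C)^n$ for some $L_B$-formula $\phi$, and relatively definable if it is so for some $B$. A weakly o-minimal pair over $A$ is $\mathbf p=(p,<)$ where $p\in S(A)$, $<$ is a relatively $A$-definable linear order on $p(\mathfrak C)$, and every relatively definable subset of $p(\mathfrak C)$ is a finite union of $<$-convex subsets of $p(\mathfrak C)$; then $p$ is called weakly o-minimal. In a weakly quasi-o-minimal theory all complete 1-types over any $A$ are weakly o-minimal. $\mathcal E_p$ is the set of all relatively $A$-definable equivalence relations on $p(\mathfrak C)$. A $\mathbf p$-semiinterval is a convex subset $S$ of $(p(\mathfrak C),<)$ such that $a=\min S$ exists and $S$ is relatively $Aa$-definable within $p(\mathfrak C)$; it is $\mathcal E_p$-determined if $S=\{x\in[a]_E\mid a\leqslant x\}$ for some $E\in\mathcal E_p$. The type $p$ has simple semiintervals if for every weakly o-minimal pair $\mathbf p=(p,<_p)$ over $A$ every $\mathbf p$-semiinterval is $\mathcal E_p$-determined; it has hereditarily simple semiintervals if every complete type (over any $B\supseteq A$) extending $p$ has simple semiintervals. $T$ has simple semiintervals if all $p\in S_1(T)$ have hereditarily simple semiintervals. *)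

(* Defs.v *)
From mathcomp Require Import all_boot.
From mathcomp Require Import boolp classical_sets functions cardinality.

Set Implicit Arguments.
Unset Strict Implicit.
Unset Printing Implicit Defensive.

Local Open Scope classical_set_scope.
Local Open Scope card_scope.

(** * First-order syntax and semantics *)

Record signature := Signature {
  fsym : Type;
  far : fsym -> nat;
  rsym : Type;
  rar : rsym -> nat
}.

Inductive term (L : signature) (V : Type) : Type :=
| Var of V
| App (f : fsym L) of ('I_(far f) -> term L V).

(* Free variables are indexed by [V]; a quantifier binds the variable [None]
   of its body. *)
Inductive formula (L : signature) (V : Type) : Type :=
| Fal
| Eql of term L V & term L V
| Rel (r : rsym L) of ('I_(rar r) -> term L V)
| Imp of formula L V & formula L V
| All of formula L (option V).

Arguments Fal {L V}.

Definition Neg (L : signature) (V : Type) (phi : formula L V) : formula L V :=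
  Imp phi Fal.

Definition sentence (L : signature) := formula L void.

Fixpoint term_rename (L : signature) (V W : Type) (g : V -> W) (t : term L V) :
    term L W :=
  match t with
  | Var x => Var L (g x)
  | App f ts => App (fun i => term_rename g (ts i))
  end.

Fixpoint rename (L : signature) (V W : Type) (g : V -> W)
    (phi : formula L V) {struct phi} : formula L W :=
  match phi with
  | Fal => Fal
  | Eql t u => Eql (term_rename g t) (term_rename g u)
  | Rel r ts => Rel (fun i => term_rename g (ts i))
  | Imp phi1 phi2 => Imp (rename g phi1) (rename g phi2)
  | All psi => All (rename (omap g) psi)
  end.

Record structure (L : signature) := Structure {
  carrier :> Type;
  carrier_inhabited : inhabited carrier;
  fint : forall f : fsym L, ('I_(far f) -> carrier) -> carrier;
  rint : forall r : rsym L, ('I_(rar r) -> carrier) -> Prop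
}.

Fixpoint eval (L : signature) (M : structure L) (V : Type) (v : V -> M)
    (t : term L V) : M :=
  match t with
  | Var x => v x
  | App f ts => fint (fun i => eval v (ts i))
  end.

Fixpoint sat (L : signature) (M : structure L) (V : Type) (v : V -> M)
    (phi : formula L V) {struct phi} : Prop :=
  match phi with
  | Fal => False
  | Eql t u => eval v t = eval v u
  | Rel r ts => rint (fun i => eval v (ts i))
  | Imp phi1 phi2 => sat v phi1 -> sat v phi2
  | All psi => forall a : M, sat (fun o => oapp v a o) psi
  end.

Definition holds (L : signature) (M : structure L) (s : sentence L) : Prop :=
  sat (fun x : void => of_void M x) s.

Definition models (L : signature) (M : structure L) (T : set (sentence L)) :=
  forall s, T s -> holds M s.

Definition entails (L : signature) (T : set (sentence L)) (s : sentence L) :=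
  forall N : structure L, models N T -> holds N s.

Definition complete_theory (L : signature) (T : set (sentence L)) :=
  (exists N : structure L, models N T) /\
  (forall s, entails T s \/ entails T (Neg s)).

(** * Parameters, definable sets and types *)

(* [L_A]-formulas in the free variables [x_0, ..., x_(n-1)]. *)
Definition formulaA (L : signature) (M : structure L) (A : set M) (n : nat) :=
  formula L ('I_n + {a : M | A a}).

Definition satA (L : signature) (M : structure L) (A : set M) (n : nat)
    (phi : formulaA A n) (x : 'I_n -> M) : Prop :=
  sat (fun w => match w with inl i => x i | inr a => proj1_sig a end) phi.

Definition liftA (L : signature) (M : structure L) (A B : set M)
    (AB : A `<=` B) (n : nat) (phi : formulaA A n) : formulaA B n :=
  rename (fun w => match w with
                   | inl i => inl i
                   | inr a => inr (exist B (proj1_sig a) (AB _ (proj2_sig a)))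
                   end) phi.

Definition rel_definable (L : signature) (M : structure L) (D A : set M)
    (n : nat) (X : set ('I_n -> M)) : Prop :=
  exists phi : formulaA A n,
    X = [set x | satA phi x] `&` [set x | forall i, D (x i)].

Definition rel_definable1 (L : signature) (M : structure L) (D A : set M)
    (X : set M) : Prop :=
  rel_definable D A [set x : 'I_1 -> M | X (x ord0)].

(* Only the restriction of [R] to [D] matters. *)
Definition rel_definable2 (L : signature) (M : structure L) (D A : set M)
    (R : M -> M -> Prop) : Prop :=
  rel_definable D A [set x : 'I_2 -> M |
    [/\ D (x ord0), D (x ord_max) & R (x ord0) (x ord_max)]].

Definition definable1 (L : signature) (M : structure L) (A X : set M) :=
  rel_definable1 setT A X.

Definition definable2 (L : signature) (M : structure L) (A : set M)
    (R : M -> M -> Prop) :=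
  rel_definable2 setT A R.

Definition finitely_satisfiable (L : signature) (M : structure L) (A : set M)
    (n : nat) (p : set (formulaA A n)) : Prop :=
  forall q : set (formulaA A n), q `<=` p -> finite_set q ->
    exists x : 'I_n -> M, forall phi, q phi -> satA phi x.

(* [complete_types A n] is S_n(A). For M a model of a complete theory T,
   S_n(T) is [complete_types set0 n]. *)
Definition complete_types (L : signature) (M : structure L) (A : set M)
    (n : nat) : set (set (formulaA A n)) :=
  [set p | finitely_satisfiable p /\ forall phi, p phi \/ p (Neg phi)].

Arguments complete_types {L M} A n.

Definition realizations (L : signature) (M : structure L) (A : set M)
    (p : set (formulaA A 1)) : set M :=
  [set a | forall phi, p phi -> satA phi (fun=> a)].

Definition extends (L : signature) (M : structure L) (A B : set M)
    (AB : A `<=` B) (p : set (formulaA A 1)) (q : set (formulaA B 1)) : Prop :=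
  forall phi, p phi -> q (liftA AB phi).

(** * Monster models *)

(* The type [K] stands for its cardinal: A is small when |A| < |K|. *)
Definition small_set (K : Type) (T : Type) (A : set T) : Prop :=
  ~ ([set: K] #<= A).

Definition saturated (K : Type) (L : signature) (M : structure L) : Prop :=
  forall A : set M, small_set K A ->
  forall p : set (formulaA A 1), finitely_satisfiable p ->
    exists a, realizations p a.

Definition elementary_on (L : signature) (M : structure L) (A : set M)
    (f : M -> M) : Prop :=
  forall (n : nat) (phi : formula L 'I_n) (x : 'I_n -> M),
    (forall i, A (x i)) -> (sat x phi <-> sat (f \o x) phi).

Definition automorphism (L : signature) (M : structure L) (s : M -> M) : Prop :=
  [/\ bijective s,
      forall (f : fsym L) (x : 'I_(far f) -> M), s (fint x) = fint (s \o x) &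
      forall (r : rsym L) (x : 'I_(rar r) -> M), rint x <-> rint (s \o x)].

Definition strongly_homogeneous (K : Type) (L : signature) (M : structure L) :
    Prop :=
  forall A : set M, small_set K A ->
  forall f : M -> M, elementary_on A f ->
    exists2 s, automorphism s & forall a, A a -> s a = f a.

(* [formula L nat] has cardinality |L| + aleph_0, that is, |T|. *)
Definition monster (K : Type) (L : signature) (T : set (sentence L))
    (M : structure L) : Prop :=
  [/\ models M T,
      small_set K [set: formula L nat],
      saturated K M &
      strongly_homogeneous K M].

(** * Linear orders, convex sets and semiintervals *)

Definition linear_order_on (T : Type) (D : set T) (lt : T -> T -> Prop) :=
  [/\ forall x, D x -> ~ lt x x,
      forall x y z, D x -> D y -> D z -> lt x y -> lt y z -> lt x z &
      forall x y, D x -> D y -> [\/ lt x y, x = y | lt y x]].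

Definition convex_in (T : Type) (D : set T) (lt : T -> T -> Prop) (X : set T) :=
  X `<=` D /\
  forall x y z, X x -> D y -> X z -> lt x y -> lt y z -> X y.

Definition is_min (T : Type) (lt : T -> T -> Prop) (X : set T) (a : T) :=
  X a /\ forall x, X x -> a = x \/ lt a x.

Definition finite_convex_union (T : Type) (D : set T) (lt : T -> T -> Prop)
    (X : set T) : Prop :=
  exists (m : nat) (C : 'I_m -> set T),
    (forall i, convex_in D lt (C i)) /\ X = \bigcup_i C i.

Inductive boolean_combination (T : Type) (G : set (set T)) : set T -> Prop :=
| bc_gen X of G X : boolean_combination G X
| bc_compl X of boolean_combination G X : boolean_combination G (~` X)
| bc_union X Y of boolean_combination G X & boolean_combination G Y :
    boolean_combination G (X `|` Y).

Definition zero_definable_order (L : signature) (M : structure L)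
    (lt : M -> M -> Prop) : Prop :=
  linear_order_on [set: M] lt /\ definable2 set0 lt.

Definition weakly_quasi_o_minimal (L : signature) (M : structure L) : Prop :=
  exists2 lt : M -> M -> Prop, zero_definable_order lt &
    forall A X : set M, definable1 A X ->
      boolean_combination
        [set Y | definable1 set0 Y \/ convex_in setT lt Y] X.

Definition weakly_o_minimal_wrt (L : signature) (M : structure L)
    (lt : M -> M -> Prop) : Prop :=
  forall A X : set M, definable1 A X -> finite_convex_union setT lt X.

Definition weakly_o_minimal (L : signature) (M : structure L) : Prop :=
  exists2 lt : M -> M -> Prop,
    zero_definable_order lt & weakly_o_minimal_wrt lt.

Definition small_theory (L : signature) (M : structure L) : Prop :=
  forall n : nat, countable (complete_types (set0 : set M) n).

Definition definable_semiinterval_family (L : signature) (M : structure L)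
    (lt : M -> M -> Prop) (S : M -> set M) : Prop :=
  [/\ forall a, convex_in setT lt (S a),
      forall a, is_min lt (S a) a &
      exists A : set M, definable2 A S].

(* [spower S a n] is S_a^(n+1). *)
Fixpoint spower (T : Type) (S : T -> set T) (a : T) (n : nat) : set T :=
  if n is m.+1 then \bigcup_(t in spower S a m) S t else S a.

Definition is_shift (T : Type) (S : T -> set T) (a : T) : Prop :=
  forall n, spower S a n `<` spower S a n.+1.

Definition admits_shift (L : signature) (M : structure L)
    (lt : M -> M -> Prop) : Prop :=
  exists S : M -> set M,
    definable_semiinterval_family lt S /\ exists a, is_shift S a.

(** * Simple semiintervals *)

Definition weakly_o_minimal_pair (L : signature) (M : structure L)
    (A : set M) (p : set (formulaA A 1)) (lt : M -> M -> Prop) : Prop :=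
  [/\ complete_types A 1 p,
      linear_order_on (realizations p) lt,
      rel_definable2 (realizations p) A lt &
      forall B X : set M, X `<=` realizations p ->
        rel_definable1 (realizations p) B X ->
        finite_convex_union (realizations p) lt X].

Definition rel_definable_equivalence (L : signature) (M : structure L)
    (A : set M) (p : set (formulaA A 1)) (E : M -> M -> Prop) : Prop :=
  let D := realizations p in
  [/\ forall x, D x -> E x x,
      forall x y, D x -> D y -> E x y -> E y x,
      forall x y z, D x -> D y -> D z -> E x y -> E y z -> E x z &
      rel_definable2 D A E].

Definition type_semiinterval (L : signature) (M : structure L)
    (A : set M) (p : set (formulaA A 1)) (lt : M -> M -> Prop) (a : M)
    (S : set M) : Prop :=
  [/\ convex_in (realizations p) lt S,
      is_min lt S a &
      rel_definable1 (realizations p) (A `|` [set a]) S].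

Definition determined (L : signature) (M : structure L)
    (A : set M) (p : set (formulaA A 1)) (lt : M -> M -> Prop) (a : M)
    (S : set M) : Prop :=
  exists2 E, rel_definable_equivalence p E &
    S = [set x | [/\ realizations p x, E a x & a = x \/ lt a x]].

Definition simple_semiintervals (L : signature) (M : structure L)
    (A : set M) (p : set (formulaA A 1)) : Prop :=
  forall lt, weakly_o_minimal_pair p lt ->
  forall a S, type_semiinterval p lt a S -> determined p lt a S.

Definition hereditarily_simple_semiintervals (K : Type) (L : signature)
    (M : structure L) (A : set M) (p : set (formulaA A 1)) : Prop :=
  forall (B : set M) (AB : A `<=` B) (q : set (formulaA B 1)),
    small_set K B -> complete_types B 1 q -> extends AB p q ->
    simple_semiintervals q.

Definition theory_simple_semiintervals (K : Type) (L : signature)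
    (M : structure L) : Prop :=
  forall p : set (formulaA (set0 : set M) 1),
    complete_types set0 1 p -> hereditarily_simple_semiintervals K p.

(* Main.v *)
Require Import Defs.
From mathcomp Require Import all_boot.
From mathcomp Require Import boolp classical_sets functions cardinality.

(** Fix a complete type over a small set [B] and its locus [D], on which the
    automorphisms fixing [B] act transitively.

    (a) Suppose there are no shifts. For a family [S] whose endpoint is a
    nondecreasing function of the starting point, the powers of [S] stabilize, and
    this forces [S] to be determined by an equivalence relation on [D]. An
    arbitrary family is compared with a nondecreasing one above it; weak
    o-minimality of [D] excludes that the two differ. Applied to the families "at
    most [n] alternations of [phi(a,-)] up to [y]", this shows that the truth value
    of any formula [phi(a,y)] on [D] is controlled by the chain of convex invariant
    equivalence relations [H] with [H a y]. Hence a semiinterval of [D] for an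
    arbitrary order [<_p] is determined by such an equivalence relation.

    (b) Given a shift at [a], replace [S] by a nondecreasing family and let [Pi] be
    the union of the powers of [S_a]. Smallness or weak o-minimality yields a
    definable set [X0] cofinal in [Pi] which no 0-definable set splits into two
    cofinal pieces; by weak quasi-o-minimality, no definable set does, so [X0]
    determines a complete type at the end of [Pi]. Extending [S_x] over the next gap
    of [X0] gives a semiinterval of this type. Were it determined by an equivalence
    relation, then by compactness the extended family would be transitive on a final
    part of [X0], which contradicts the strict growth of the powers of [S].

    Both parts use that weak o-minimality of a type does not depend on the order. *)

Set Implicit Arguments.
Unset Strict Implicit.
Unset Printing Implicit Defensive.

Local Open Scope classical_set_scope.
Local Open Scope card_scope.

(** * Linear orders and alternation *)

Section LinearOrder.
Variables (T : Type) (lt : T -> T -> Prop).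
Hypothesis O : linear_order_on [set: T] lt.

Lemma lo_irr x : ~ lt x x. Proof. by case: O => h _ _; apply: h. Qed.

Lemma lo_tr x y z : lt x y -> lt y z -> lt x z.
Proof. by case: O => _ h _; apply: h. Qed.

Lemma lo_tot x y : [\/ lt x y, x = y | lt y x].
Proof. by case: O => _ _ h; apply: h. Qed.

Lemma lo_asym x y : lt x y -> ~ lt y x.
Proof. by move=> h1 h2; apply: (@lo_irr x); apply: lo_tr h2. Qed.

Lemma lo_nlt x y : ~ lt x y -> x = y \/ lt y x.
Proof. by case: (lo_tot x y); tauto. Qed.

Lemma lo_lt_le x y z : lt x y -> ~ lt z y -> lt x z.
Proof. by move=> h /lo_nlt [->//|]; apply: lo_tr. Qed.

Lemma lo_le_lt x y z : ~ lt y x -> lt y z -> lt x z.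
Proof. by move=> /lo_nlt [->//|]; apply: lo_tr. Qed.

Lemma lo_le_le x y z : ~ lt y x -> ~ lt z y -> ~ lt z x.
Proof. by move=> h1 h2 h3; apply: h1; apply: lo_le_lt h3. Qed.

Lemma lo_anti x y : ~ lt y x -> ~ lt x y -> x = y.
Proof. by move=> /lo_nlt [|//]. Qed.

Lemma lo_rev : linear_order_on [set: T] (fun x y => lt y x).
Proof.
split=> [x _|x y z _ _ _ h1 h2|x y _ _]; first exact: lo_irr.
  exact: lo_tr h1.
by case: (lo_tot x y); [constructor 3|constructor 2|constructor 1].
Qed.

End LinearOrder.

Ltac absent P := assert_fails (assert P by assumption).

Ltac ord_sat O :=
  lazymatch type of O with linear_order_on _ ?lt =>
  repeat match goal with
  | H1 : lt ?x ?y, H2 : lt ?y ?z |- _ =>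
      absent (lt x z); have := lo_tr O H1 H2; intro
  | H1 : lt ?x ?y, H2 : ~ lt ?z ?y |- _ =>
      absent (lt x z); have := lo_lt_le O H1 H2; intro
  | H1 : ~ lt ?y ?x, H2 : lt ?y ?z |- _ =>
      absent (lt x z); have := lo_le_lt O H1 H2; intro
  | H1 : ~ lt ?y ?x, H2 : ~ lt ?z ?y |- _ =>
      absent (~ lt z x); have := lo_le_le O H1 H2; intro
  end end.

(* Decides goals [lt x y], [~ lt x y], [x = y] and [False] from hypotheses
   [lt u v] and [~ lt u v]. *)
Ltac ord O :=
  try subst;
  lazymatch type of O with linear_order_on _ ?lt =>
  lazymatch goal with
  | |- ~ _ => intro
  | |- lt ?x ?y => apply: contrapT; intro
  | |- ?x = ?y => apply: (lo_anti O); intro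
  | |- False => idtac
  end;
  ord_sat O;
  match goal with
  | H : lt ?x ?x |- _ => by case: (lo_irr O H)
  | H : ~ lt ?x ?y, H' : lt ?x ?y |- _ => by case: (H H')
  end end.

(** * Coherent families and the equivalence relations they define *)

Section Coherent.
Variables (T : Type) (lt : T -> T -> Prop) (D : set T) (S : T -> T -> Prop).

(** Passing from [a] to a point [b] of [S a] does not change the upper end. For convex sets with a
    minimum, this means that [S a] is the part above [a] of a class of [S x y \/ S y x], which is
    then a convex equivalence relation by [coherent_trans] and [coherent_between]. *)
Definition coherent := forall a b y, D a -> D b -> D y ->
  S a b -> ~ lt y b -> (S a y <-> S b y).

Hypothesis O : linear_order_on [set: T] lt.
Hypothesis Sge : forall a y, D a -> D y -> S a y -> ~ lt y a.
Hypothesis Sconv : forall a x y, D a -> D x -> D y ->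
  S a y -> ~ lt x a -> ~ lt y x -> S a x.
Hypothesis coh : coherent.

Lemma coherent_trans x y z : D x -> D y -> D z ->
  S x y \/ S y x -> S y z \/ S z y -> S x z \/ S z x.
Proof.
have V a b c : D a -> D b -> D c -> S a b -> S a c -> S b c \/ S c b.
  move=> Da Db Dc ab ac; have [cb|cb] := pselect (lt c b).
    by right; apply/(coh Da Dc Db ac); [ord O|].
  by left; apply/(coh Da Db Dc ab).
have W a b c : D a -> D b -> D c -> S b a -> S c a -> S b c \/ S c b.
  move=> Da Db Dc ba ca.
  have h1 := Sge Db Da ba; have h2 := Sge Dc Da ca.
  have [cb|cb] := pselect (lt c b).
    by right; apply: (Sconv (y := a)) => //; ord O.
  by left; apply: (Sconv (y := a)).
move=> Dx Dy Dz [xy|yx] [yz|zy].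
- by left; apply/(coh Dx Dy Dz xy) => //; exact: Sge.
- exact: (W y).
- exact: (V y).
- by right; apply/(coh Dz Dy Dx zy) => //; exact: Sge.
Qed.

Lemma coherent_between x y z : D x -> D y -> D z -> S x x ->
  S x z \/ S z x -> ~ lt y x -> ~ lt z y -> S x y \/ S y x.
Proof.
move=> Dx Dy Dz Sxx [h|h] xy yz; first by left; apply: Sconv h _ _.
have xz := Sge Dz Dx h.
have -> : y = x by ord O.
by left.
Qed.

End Coherent.

Section Alternation.
Variables (T : Type) (lt : T -> T -> Prop).

(* A chain [t_0 > u_0 > t_1 > ...] of [n+1] points below [y], taken alternately
   from [P] and [Q], starting with the topmost one in [P]. *)
Fixpoint alt (P Q : set T) (n : nat) (y : T) : Prop :=
  exists t, [/\ ~ lt y t, P t & if n is m.+1 then alt Q P m t else True].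

Lemma alt0 P Q y : P y -> ~ lt y y -> alt P Q 0 y.
Proof. by move=> Py hy; exists y. Qed.

Hypothesis O : linear_order_on [set: T] lt.

Lemma altS (P Q : set T) n x y : P y -> ~ lt y x -> alt Q P n x ->
  alt P Q n.+1 y.
Proof.
move=> Py xy h; exists y; split=> //; first exact: (lo_irr O).
by case: n h => [|n] [t [h1 h2 h3]]; exists t; split=> //; ord O.
Qed.

Lemma alt_ge (P Q : set T) n x y : ~ lt y x -> alt P Q n x -> alt P Q n y.
Proof. by move=> xy; case: n => [|n] [t [h1 h2 h3]]; exists t; split=> //; ord O. Qed.

Lemma alt_sub (P Q P' Q' : set T) n y :
  (forall x, ~ lt y x -> P x -> P' x) -> (forall x, ~ lt y x -> Q x -> Q' x) ->
  alt P Q n y -> alt P' Q' n y.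
Proof.
elim: n P Q P' Q' y => [|n IH] P Q P' Q' y hP hQ [t [ty Pt h]].
  by exists t; split; auto.
exists t; split; auto.
by apply: IH h => x xt; [apply: hQ|apply: hP]; ord O.
Qed.

Lemma alt_top (P Q : set T) n y : alt P Q n y ->
  exists t, [/\ ~ lt y t, P t & alt P Q n t].
Proof.
case: n => [|n] [t [ty Pt h]]; exists t; split=> //; exists t; split=> //;
  exact: (lo_irr O).
Qed.

Lemma alt_pred (P Q : set T) n y : alt P Q n.+1 y -> alt Q P n y.
Proof. by move=> [t [ty _ h]]; apply: alt_ge h. Qed.

Lemma alt_le (P Q : set T) m n y : (m <= n)%N -> alt P Q n y -> alt P Q m y.
Proof.
elim: m n P Q y => [|m IH] [|n] P Q y //= mn [t [ty Pt h]]; exists t; split=> //.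
exact: IH h.
Qed.

End Alternation.

Lemma alt_transport (T T' : Type) (lt : T -> T -> Prop)
    (lt' : T' -> T' -> Prop) (s : T -> T') (P Q : set T) (P' Q' : set T') n y :
  (forall x z, lt' (s x) (s z) -> lt x z) ->
  (forall x, P x -> P' (s x)) -> (forall x, Q x -> Q' (s x)) ->
  alt lt P Q n y -> alt lt' P' Q' n (s y).
Proof.
move=> hs; elim: n P Q P' Q' y => [|n IH] P Q P' Q' y hP hQ [t [ty Pt h]].
  by exists (s t); split; auto.
by exists (s t); split; auto; apply: IH h.
Qed.

(** * Finite unions of convex sets *)

Section FiniteConvexUnions.
Variables (T : Type) (D : set T) (lt : T -> T -> Prop).

Let fcu := finite_convex_union D lt.

Lemma fcu_convex X : convex_in D lt X -> fcu X.
Proof.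
move=> cX; exists 1%N, (fun=> X); split=> //.
by rewrite predeqE => x; split=> [Xx|[]//]; exists ord0.
Qed.

Lemma fcuU X Y : fcu X -> fcu Y -> fcu (X `|` Y).
Proof.
move=> [m [C [cC ->]]] [n [C' [cC' ->]]].
exists (m + n)%N, (fun i => match fintype.split i with inl j => C j | inr j => C' j end).
split=> [i|]; first by case: fintype.split.
rewrite predeqE => x; split.
  move=> [[i _ h]|[i _ h]].
    by exists (unsplit (inl i)) => //; rewrite unsplitK.
  by exists (unsplit (inr i)) => //; rewrite unsplitK.
by move=> [i _]; case: fintype.split => j h; [left|right]; exists j.
Qed.

Lemma fcu_bigcup n (F : 'I_n -> set T) : (forall i, fcu (F i)) ->
  fcu (\bigcup_i F i).
Proof.
elim: n F => [|n IH] F hF.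
  by exists 0%N, F; split=> [[]|].
suff -> : \bigcup_i F i = F ord0 `|` \bigcup_i F (lift ord0 i).
  by apply: fcuU => //; apply: IH.
rewrite predeqE => x; split.
  by move=> [i _ h]; case: (unliftP ord0 i) h => [j|] -> h; [right; exists j|left].
by move=> [h|[i _ h]]; [exists ord0|exists (lift ord0 i)].
Qed.

Hypothesis O : linear_order_on [set: T] lt.

Lemma convexI X Y : convex_in D lt X -> convex_in D lt Y ->
  convex_in D lt (X `&` Y).
Proof.
move=> [XD cX] [YD cY]; split=> [x [/XD]//|x y z [Xx Yx] Dy [Xz Yz] xy yz].
by split; [apply: (cX x y z)|apply: (cY x y z)].
Qed.

Lemma convex_between X x y z : convex_in D lt X -> X x -> D y -> X z ->
  ~ lt y x -> ~ lt z y -> X y.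
Proof.
move=> [_ cX] Xx Dy Xz xy yz.
case: (lo_nlt O xy) => [->//|{}xy]; case: (lo_nlt O yz) => [<-//|{}yz].
exact: (cX x y z).
Qed.

Lemma fcuI X Y : fcu X -> fcu Y -> fcu (X `&` Y).
Proof.
move=> [m [C [cC ->]]] [n [C' [cC' ->]]].
suff -> : (\bigcup_i C i) `&` (\bigcup_i C' i) = \bigcup_i \bigcup_j (C i `&` C' j).
  by do 2!apply: fcu_bigcup => ?; apply/fcu_convex/convexI.
rewrite predeqE => x; split=> [[[i _ h] [j _ h']]|[i _ [j _ [h h']]]].
  by exists i => //; exists j.
by split; [exists i|exists j].
Qed.

Lemma fcuC X : fcu X -> fcu (D `\` X).
Proof.
move=> [m [C [cC ->]]].
elim: m C cC => [|n IH] C cC.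
  by apply: fcu_convex; split=> [x []//|x y z [Dx h] Dy _ _ _]; split=> // -[[]].
suff -> : D `\` \bigcup_i C i =
    (D `\` C ord0) `&` (D `\` \bigcup_i C (lift ord0 i)).
  apply: fcuI; last by apply: IH.
  suff -> : D `\` C ord0 =
     [set x | D x /\ forall y, C ord0 y -> lt x y] `|`
     [set x | [/\ D x, (exists y, C ord0 y) & forall y, C ord0 y -> lt y x]].
    apply: fcuU; apply: fcu_convex; split.
    - by move=> x [].
    - by move=> x y z [Dx hx] Dy [Dz hz] xy yz; split=> // w /hz h; ord O.
    - by move=> x [].
    - move=> x y z [Dx e hx] Dy [Dz _ hz] xy yz; split=> // w /hx h; ord O.
  rewrite predeqE => x; split=> [[Dx nx]|].
    have [[y Cy]|no] := pselect (exists y, C ord0 y); last first.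
      by left; split=> // y Cy; case: no; exists y.
    have [h|h] := pselect (lt x y); [left|right]; split=> //.
    - move=> w Cw; apply: contrapT => xw; apply: nx.
      by apply: (@convex_between _ w x y) => //; ord O.
    - by exists y.
    - move=> w Cw; apply: contrapT => xw; apply: nx.
      by apply: (@convex_between _ y x w) => //; ord O.
  by move=> [[Dx h]|[Dx _ h]]; split=> // /h /(lo_irr O).
rewrite predeqE => x; split.
  move=> [Dx h]; split; split=> //; first by move=> Cx; apply: h; exists ord0.
  by move=> [i _ Ci]; apply: h; exists (lift ord0 i).
move=> [[Dx h1] [_ h2]]; split=> // -[i _].
by case: (unliftP ord0 i) => [j|] -> // Cj; apply: h2; exists j.
Qed.

(** Two points of the same convex piece of [X] have no point of [D] outside [X] between them, so an
    alternating chain uses each piece at most once. *)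
Lemma fcu_alt X : fcu X -> exists n, forall (P Q : set T) m y,
  P `<=` X -> Q `<=` D `\` X -> (n <= m)%N ->
  ~ alt lt P Q m y /\ ~ alt lt Q P m y.
Proof.
move=> [m [C [cC ->]]].
(* [I] collects the pieces still available; passing below a point of [Q] removes the piece just
   used. A chain of index [k.*2] has [k.+1] points in [P], one more than there are pieces. *)
suff H : forall k (I : {set 'I_m}) (P Q : set T) y, (#|I| <= k)%N ->
    P `<=` [set x | exists2 i, i \in I & C i x] ->
    Q `<=` D `\` \bigcup_i C i -> ~ alt lt P Q (k.*2) y.
  (* One more than [m.*2], to cover the chains whose top lies in [Q]. *)
  exists m.*2.+1 => P Q n y PX QX mn.
  have K : forall y, ~ alt lt P Q m.*2 y.
    move=> z; apply: (H m (finset.setTfor 'I_m)) => //; first by rewrite cardsT card_ord.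
    by move=> x /PX [i _ h]; exists i.
  split=> h; first by apply: (K y); apply: alt_le h; apply: ltnW.
  by apply: (K y); apply: (alt_pred O); apply: alt_le h.
elim=> [|k IH] I P Q y.
  rewrite leqn0 cards_eq0 => /eqP -> PX _ [t [_ /PX [i]]].
  by rewrite inE.
move=> Ik PX QX [t [ty Pt [t1 [tt1 Qt1 h]]]].
have [i iI Ct] := PX _ Pt.
apply: (IH (I :\ i) [set x | P x /\ ~ lt t1 x] Q t1) => //.
- by move: Ik; rewrite (cardsD1 i) iI.
- move=> x [Px xt]; have [j jI Cj] := PX _ Px; exists j => //.
  rewrite !inE jI andbT; apply/eqP => ji; subst j.
  have [Dt1] := QX _ Qt1; apply; exists i => //.
  by apply: (convex_between (cC i) Cj _ Ct).
- by apply: (alt_sub O) h => x xt1.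
Qed.

End FiniteConvexUnions.

(** * Two linear orders with a common transitive group of automorphisms *)

Lemma alt_unbounded (U : Type) (lt : U -> U -> Prop) (P Q : set U) w :
  linear_order_on [set: U] lt ->
  P w -> (forall x, P x -> exists2 z, Q z & ~ lt z x) ->
  (forall x, Q x -> exists2 z, P z & ~ lt z x) ->
  forall n, exists y, alt lt P Q n y.
Proof.
move=> O Pw PQ QP n.
suff [y []] : exists y, P y /\ alt lt P Q n y by exists y.
elim: n P Q w Pw PQ QP => [|n IH] P Q w Pw PQ QP.
  by exists w; split=> //; apply: alt0 => //; apply: (lo_irr O).
have [z Qz zw] := PQ _ Pw.
have [y [Qy h]] := IH Q P z Qz QP PQ.
have [x Px xy] := QP _ Qy.
by exists x; split=> //; apply: (altS O Px xy).
Qed.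

Lemma fcu_rev (U : Type) (D : set U) (lt : U -> U -> Prop) X :
  finite_convex_union D lt X -> finite_convex_union D (fun x y => lt y x) X.
Proof.
move=> [m [C [cC ->]]]; exists m, C; split=> // i; have [h1 h2] := cC i.
by split=> // x y z Cx Dy Cz xy yz; apply: (h2 z y x).
Qed.

Definition transitive_autos (U : Type) (lt lt' : U -> U -> Prop) :=
  forall a b : U, exists s : U -> U,
    [/\ forall y, exists x, s x = y,
        forall x y, lt (s x) (s y) <-> lt x y,
        forall x y, lt' (s x) (s y) <-> lt' x y & s a = b].

Section TwoOrders.
Variables (U : Type) (lt lt' : U -> U -> Prop).
Hypothesis O : linear_order_on [set: U] lt.
Hypothesis O' : linear_order_on [set: U] lt'.
Hypothesis G : transitive_autos lt lt'.
Hypothesis fin : forall a, finite_convex_union setT lt [set x | lt' a x].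

Definition agree a : set U := [set x | lt a x /\ lt' a x].
Definition disagree a : set U := [set x | lt a x /\ lt' x a].

Definition bounded_changes k := forall a y,
  ~ alt lt (agree a) (disagree a) k y /\ ~ alt lt (disagree a) (agree a) k y.

(** The convex hull, for [lt], of [a] together with [disagree a]. *)
Definition hull a : set U :=
  [set x | x = a \/ (lt a x /\ exists2 w, disagree a w & ~ lt w x)].

(** The largest final segment of [hull a] contained in [disagree a]. *)
Definition hull_end a : set U :=
  [set x | hull a x /\ forall z, hull a z -> ~ lt z x -> disagree a z].

Let OO := lo_rev O.

Lemma hull_ge a x : hull a x -> ~ lt x a.
Proof. by move=> [->|[h _]]; [apply: (lo_irr O)|apply: (lo_asym O)]. Qed.

Lemma disagree_hull a x : disagree a x -> hull a x.
Proof. by move=> [h1 h2]; right; split=> //; exists x => //; exact: (lo_irr O). Qed.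

Lemma hull_convex a x y : hull a y -> ~ lt x a -> ~ lt y x -> hull a x.
Proof.
move=> [->|[ay [w dw yw]]] ax xy; first by left; ord O.
by case: (lo_nlt O ax) => [|h]; [left|right; split=> //; exists w => //; ord O].
Qed.

Lemma hull_sub_disagree a b : disagree a b -> hull b `<=` hull a.
Proof.
move=> dab x [->|]; first exact: disagree_hull.
case: dab => ab ba [bx [w [bw wb] xw]]; right; split; first by ord O.
by exists w => //; split; [ord O|apply: (lo_tr O') ba].
Qed.

Lemma hull_end_up a b x : hull_end a b -> hull a x -> ~ lt x b -> hull_end a x.
Proof. by move=> [_ h] ax bx; split=> // z az xz; apply: h => //; ord O. Qed.

Lemma hull_end_disagree a x : hull_end a x -> disagree a x.
Proof. by move=> [h1 h2]; apply: h2 => //; exact: (lo_irr O). Qed.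

(** Disagreement is cofinal in [hull a]. If agreement were cofinal too, the two would alternate
    without bound. *)
Lemma hull_end_nonempty k a w : bounded_changes k -> disagree a w ->
  exists x, hull_end a x.
Proof.
move=> bk dw; apply: contrapT => no.
suff [y h] : exists y, alt lt (disagree a) (agree a `&` hull a) k y.
  by case: (bk a y) => _; apply; apply: (alt_sub O) h => // x _ [].
apply: (alt_unbounded O dw) => [x dx|x [[ax ax'] [e|[_ [z dz xz]]]]].
- apply: contrapT => no2; apply: no; exists x; split; first exact: disagree_hull.
  move=> z az xz; apply: contrapT => ndz; apply: no2; exists z => //.
  split=> //; split; first by case: dx => *; ord O.
  apply: contrapT => naz; apply: ndz; split; first by case: dx => *; ord O.
  by case: (lo_nlt O' naz) => // e; subst z; case: dx => *; exfalso; ord O.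
- by exfalso; subst x; apply: (lo_irr O) ax.
- by exists z.
Qed.

(** Seen from its upper end [y0], disagreement is an [lt']-ray cut off at [y0], hence a finite
    convex union for [lt]; the automorphisms make the bound independent of the point. *)
Lemma bounded_below : exists n, forall y a m, (n <= m)%N ->
  ~ alt (fun u v => lt v u) (disagree^~ y) (~` (disagree^~ y)) m a.
Proof.
have [[y0]|no] := pselect (inhabited U); last first.
  by exists 0%N => y; case: no.
have cL : convex_in setT lt [set x | lt x y0].
  by split=> // x y z /= *; ord O.
have f0 : finite_convex_union setT lt (disagree^~ y0).
  suff -> : disagree^~ y0 = [set x | lt' y0 x] `&` [set x | lt x y0].
    by apply: fcuI => //; apply: fcu_convex.
  by rewrite predeqE => x; split=> [[]|[]].
have [n hn] := fcu_alt OO (fcu_rev f0).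
exists n => y a m nm h.
have [s [ss s1 s2 sy]] := G y y0.
have h' : alt (fun u v => lt v u) (disagree^~ y0) (~` (disagree^~ y0)) m (s a).
  apply: alt_transport h => [x z|x|x] /=; first by rewrite s1.
    by rewrite /disagree /= -sy s1 s2.
  by rewrite /disagree /= -sy s1 s2.
by case: (hn (disagree^~ y0) (~` (disagree^~ y0)) m (s a)) => //; rewrite setTD.
Qed.

Lemma disagree_auto s : (forall x y, lt (s x) (s y) <-> lt x y) ->
  (forall x y, lt' (s x) (s y) <-> lt' x y) ->
  forall u v, disagree (s u) (s v) <-> disagree u v.
Proof. by move=> s1 s2 u v; rewrite /disagree /= s1 s2. Qed.

Lemma hull_auto s : (forall y, exists x, s x = y) ->
  (forall x y, lt (s x) (s y) <-> lt x y) ->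
  (forall x y, lt' (s x) (s y) <-> lt' x y) ->
  forall u v, hull (s u) (s v) <-> hull u v.
Proof.
move=> ss s1 s2 u v; have sd := disagree_auto s1 s2.
split=> -[e|[h [w dw vw]]].
- by left; apply: (lo_anti O) => h; move/s1: h; rewrite e; exact: lo_irr.
- have [w' e] := ss w; subst w; right; split; first exact/s1.
  by exists w'; [apply/sd|move=> h'; apply: vw; apply/s1].
- by left; rewrite e.
- right; split; first exact/s1.
  by exists (s w); [apply/sd|move/s1].
Qed.

(** A counterexample at [a] is copied to every point [c]. Stacking copies, each one starting at the
    point [x'] of the previous one, yields a point [y] above all of them such that the starting
    points disagree with [y] and the points [b'] between them do not. This contradicts
    [bounded_below]. *)
Lemma hull_end_convex a b x :
  hull_end a b -> hull a x -> ~ lt x b -> hull b x.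
Proof.
move=> ab ax bx; apply: contrapT => nb.
have bad c : exists b' x', [/\ hull_end c b', hull c x', ~ lt x' b' & ~ hull b' x'].
  have [s [ss s1 s2 <-]] := G a c.
  have sd := disagree_auto s1 s2; have sh := hull_auto ss s1 s2.
  exists (s b), (s x); split; [|exact/sh|by move/s1|by move/sh].
  case: ab => h1 h2; split; first exact/sh.
  move=> z; have [z' <-] := ss z; move=> /sh az' bz'; apply/sd; apply: h2 => //.
  by move=> h; apply: bz'; apply/s1.
have [n hn] := bounded_below.
suff H m c : exists2 y, hull_end c y &
    alt (fun u v => lt v u) (disagree^~ y) (~` (disagree^~ y)) m.*2 c.
  have [y _] := H n a; apply: hn.
  by rewrite -addnn leq_addr.
elim: m c => [|m IH] c; have [b' [x' [h1 h2 h3 h4]]] := bad c.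
  exists b' => //; apply: alt0; last exact: (lo_irr O).
  exact: hull_end_disagree.
have [y hy h] := IH x'.
have cx : hull_end c x' by apply: hull_end_up h1 h2 h3.
have xy : ~ lt y x' by apply: hull_ge; case: hy.
have cy : hull_end c y.
  apply: (hull_end_up cx) => //; apply: (hull_sub_disagree (hull_end_disagree cx)).
  by case: hy.
exists y => //.
have bc : ~ lt b' c by apply: hull_ge; case: h1.
apply: (altS (x := b') OO); [exact: hull_end_disagree|by []|].
apply: (altS (x := x') OO) => //=.
move=> /disagree_hull hb; apply: h4; apply: hull_convex hb _ _; ord O.
Qed.

(** Take [l] in [hull_end a]. All points of [hull l] lie in [hull_end a], so [hull_end_convex], used
    in both directions, gives coherence at [l]; an automorphism carries it from [l] to [a]. *)
Lemma hull_coherent k : bounded_changes k -> coherent lt setT hull.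
Proof.
move=> bk a b x _ _ _.
have [[w dw]|no] := pselect (exists w, disagree a w); last first.
  move=> [->//|[_ [w dw]]]; by case: no; exists w.
have [l al] := hull_end_nonempty bk dw.
have H c y : hull l c -> ~ lt y c -> (hull l y <-> hull c y).
  move=> lc cy.
  have ll := hull_ge lc.
  have ac : hull_end a c.
    apply: (hull_end_up al) => //.
    exact: (hull_sub_disagree (hull_end_disagree al)).
  split=> [ly|hcy].
    apply: hull_end_convex ac _ cy.
    exact: (hull_sub_disagree (hull_end_disagree al)).
  apply: hull_end_convex al _ _; last by ord O.
  exact: (hull_sub_disagree (hull_end_disagree ac)).
have [s [ss s1 s2 sl]] := G l a.
have sh := hull_auto ss s1 s2.
have [b' eb] := ss b; have [x' ex] := ss x; subst a b x.
by rewrite !sh s1; exact: H.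
Qed.


Definition hull_eqv x y := hull x y \/ hull y x.

(** [lt'] reversed inside each class of [hull_eqv]; between different classes [lt] and [lt']
    coincide by [hull_eqvN]. *)
Definition flip x y :=
  (hull_eqv x y /\ lt' y x) \/ (~ hull_eqv x y /\ lt x y).

Variable k : nat.
Hypothesis bk : bounded_changes k.

Lemma hull_eqv_refl x : hull_eqv x x. Proof. by left; left. Qed.

Lemma hull_eqv_sym x y : hull_eqv x y -> hull_eqv y x. Proof. by move=> []; [right|left]. Qed.

Lemma hull_eqv_trans x y z : hull_eqv x y -> hull_eqv y z -> hull_eqv x z.
Proof.
apply: (coherent_trans O (D := setT)) => //; last exact: hull_coherent bk.
- by move=> a u _ _; exact: hull_ge.
- by move=> a u v _ _ _; exact: hull_convex.
Qed.

Lemma hull_eqv_between x y z : hull_eqv x z -> ~ lt y x -> ~ lt z y ->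
  hull_eqv x y.
Proof.
apply: (coherent_between O (D := setT)) => //; last by left.
- by move=> a u _ _; exact: hull_ge.
- by move=> a u v _ _ _; exact: hull_convex.
Qed.

Lemma hull_eqvN_lt x y z w : hull_eqv x z -> hull_eqv y w -> ~ hull_eqv x y ->
  lt x y -> lt z w.
Proof.
move=> xz yw nxy xy; apply: contrapT => wz; apply: nxy.
have [yz|yz] := pselect (lt z y); last first.
  by apply: (hull_eqv_between xz); ord O.
apply: (hull_eqv_trans xz).
have wy := hull_eqv_sym yw.
apply: hull_eqv_trans wy; apply: hull_eqv_sym.
by apply: (hull_eqv_between (hull_eqv_sym yw)); ord O.
Qed.

Lemma hull_eqvN x y : ~ hull_eqv x y -> (lt' x y <-> lt x y).
Proof.
have H u v : ~ hull_eqv u v -> lt u v -> lt' u v.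
  move=> n uv; apply: contrapT => /(lo_nlt O') [e|vu].
    by apply: (lo_irr O (x := u)); rewrite {2}e.
  by apply: n; left; apply: disagree_hull.
move=> n; split; last exact: H.
move=> h; apply: contrapT => /(lo_nlt O) [e|vu].
  by apply: (lo_irr O' (x := x)); rewrite {2}e.
by apply: (lo_asym O' h); apply: H => // /hull_eqv_sym.
Qed.

Lemma flip_order : linear_order_on [set: U] flip.
Proof.
split=> [x _|x y z _ _ _|x y _ _].
- by move=> [[_ /(lo_irr O')]//|[n]]; case: n; exact: hull_eqv_refl.
- move=> [[e h]|[n h]] [[e' h']|[n' h']].
  + by left; split; [apply: hull_eqv_trans e'|apply: (lo_tr O' h')].
  + right; split.
      by move=> f; apply: n'; apply: hull_eqv_trans f; exact: hull_eqv_sym.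
    by apply: (hull_eqvN_lt (hull_eqv_sym e)) n' h'; exact: hull_eqv_refl.
  + right; split.
      by move=> f; apply: n; apply: (hull_eqv_trans f); exact: hull_eqv_sym.
    by apply: (hull_eqvN_lt _ e') n h; exact: hull_eqv_refl.
  + right; split; last by ord O.
    by move=> f; apply: n; apply: (hull_eqv_between f); ord O.
- have [e|n] := pselect (hull_eqv x y).
    case: (lo_tot O' x y) => h; [constructor 3|constructor 2|constructor 1] => //.
      by left; split=> //; exact: hull_eqv_sym.
    by left.
  case: (lo_tot O x y) => h; [constructor 1|constructor 2|constructor 3] => //.
    by right.
  by right; split=> // /hull_eqv_sym.
Qed.

Lemma flip_autos : transitive_autos lt flip.
Proof.
move=> a b; have [s [ss s1 s2 sa]] := G a b.
exists s; split=> // x y.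
by rewrite /flip /hull_eqv !(hull_auto ss s1 s2) s1 s2.
Qed.

Lemma hull_eqv_convex a : convex_in setT lt (hull_eqv a).
Proof.
split=> // x y z ax _ az xy yz.
apply: (hull_eqv_trans ax); apply: (@hull_eqv_between x y z); [|ord O|ord O].
exact: hull_eqv_trans (hull_eqv_sym ax) az.
Qed.

Lemma fcu_flip a : finite_convex_union setT lt [set x | flip a x].
Proof.
have fE := fcu_convex (hull_eqv_convex a).
have c1 : convex_in setT lt [set x | lt a x].
  by split=> // x y z /= *; ord O.
have c2 : convex_in setT lt [set a].
  by split=> // x y z /= -> _ -> *; exfalso; ord O.
suff -> : [set x | flip a x] =
   (hull_eqv a `&` (setT `\` ([set x | lt' a x] `|` [set a])))
   `|` ((setT `\` hull_eqv a) `&` [set x | lt a x]).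
  apply: fcuU; apply: fcuI => //.
  - by apply: (fcuC O); apply: fcuU => //; exact: fcu_convex.
  - exact: (fcuC O).
  - exact: fcu_convex.
rewrite predeqE => x; split.
  move=> [[e h]|[n h]]; [left|right]; split=> //; split=> // -[/= h'|/= h'].
    exact: (lo_asym O' h).
  by apply: (lo_irr O' (x := x)); rewrite {2}h'.
move=> [[e [_ n]]|[[_ n] h]]; [left|right]; split=> //.
by apply: contrapT => /(lo_nlt O') [h|h]; apply: n; [right|left].
Qed.

Lemma hull_gt a x : lt a x -> hull_eqv a x -> hull a x.
Proof. by move=> ax [//|/hull_ge]. Qed.

(** Read from the top, the pattern above [a] begins with agreement beyond [hull a], followed by
    disagreement at the end of the hull. Flipping exchanges agreement and disagreement inside the
    hull only, so these two blocks merge and one change is lost. *)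
Lemma flip_changes j (pos : forall a, exists y, lt a y /\ forall z, ~ lt z y -> lt' a z)
    (dis : forall a, exists w, disagree a w) :
  bounded_changes j.+1 ->
  forall a y, ~ alt lt (fun x => lt a x /\ flip a x) (fun x => lt a x /\ flip x a) j y
    /\ ~ alt lt (fun x => lt a x /\ flip x a) (fun x => lt a x /\ flip a x) j y.
Proof.
move=> bj a y; have [p [ap hp]] := pos a.
have pa z : ~ lt z p -> agree a z by move=> h; split; [ord O|exact: hp].
have din x : hull a x -> lt a x -> flip a x -> disagree a x.
  by move=> h ax [[_ h']|[n _]]; [split|case: n; left].
have ain x : hull a x -> lt a x -> flip x a -> agree a x.
  by move=> h ax [[_ h']|[n _]]; [split|case: n; right].
have dhull x : lt a x -> flip x a -> hull a x.
  by move=> ax [[/hull_eqv_sym e _]|[_ h]]; [apply: hull_gt ax e|exfalso; ord O].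
have top x : lt a x -> hull a x -> exists2 w, disagree a w & ~ lt w x.
  by move=> ax [e|[_]//]; subst x; case: (lo_irr O ax).
have disp w : disagree a w -> lt w p.
  move=> [aw wa]; apply: contrapT => /hp h; exact: (lo_asym O' h).
have inP n t : hull a t ->
    alt lt (fun x => lt a x /\ flip a x) (fun x => lt a x /\ flip x a) n t ->
    alt lt (disagree a) (agree a) n t.
  move=> ht; apply: (alt_sub O) => x xt [ax h]; [apply: din|apply: ain] => //.
    by apply: hull_convex ht _ _; ord O.
  by apply: hull_convex ht _ _; ord O.
have inN n t : hull a t ->
    alt lt (fun x => lt a x /\ flip x a) (fun x => lt a x /\ flip a x) n t ->
    alt lt (agree a) (disagree a) n t.
  move=> ht; apply: (alt_sub O) => x xt [ax h]; [apply: ain|apply: din] => //.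
    by apply: hull_convex ht _ _; ord O.
  by apply: hull_convex ht _ _; ord O.
have tt t : ~ lt t t by exact: (lo_irr O).
split=> /(alt_top O) [t [ty [lat fat] h]].
- have [ht|nht] := pselect (hull a t).
    have [w dw wt] := top _ lat ht; have wp := disp _ dw.
    by apply: (bj a p).1; apply: (altS O (x := t)); [exact: pa|ord O|exact: inP].
  have [w0 dw0] := dis a; have wp0 := disp _ dw0.
  case: j bj h => [|m] bj h.
    by apply: (bj a p).1; apply: (altS O (x := w0)); [exact: pa|ord O|exact: alt0].
  case: h => t' [_ _ /(alt_top O) [t1 [t1t [at1 ft1] h1]]].
  have ht1 := dhull _ at1 ft1.
  have [w dw wt] := top _ at1 ht1; have wp := disp _ dw.
  apply: (bj a p).1; apply: (altS O (x := w)); [exact: pa|ord O|].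
  by apply: (altS O (x := t1)) => //; exact: inN.
- have ht := dhull _ lat fat; have [w dw wt] := top _ lat ht.
  by apply: (bj a w).2; apply: (altS O (x := t)) => //; exact: inN.
Qed.

(** A convex set for [flip] contains every class strictly between two classes that it meets, and its
    traces on a lowest and on a highest class remain convex when the order of the class is reversed.
    It is therefore a union of three [lt']-convex sets. *)
Lemma fcu_unflip X :
  finite_convex_union setT flip X -> finite_convex_union setT lt' X.
Proof.
pose prec x y := ~ hull_eqv x y /\ lt x y.
have precE x y z w : hull_eqv x z -> hull_eqv y w -> prec x y -> prec z w.
  move=> e1 e2 [n h]; split; last exact: hull_eqvN_lt e1 e2 n h.
  move=> f; apply: n; apply: hull_eqv_trans e1 _; apply: hull_eqv_trans f _.
  exact: hull_eqv_sym.
have precT x y z : prec x y -> prec y z -> prec x z.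
  move=> [n1 h1] [n2 h2]; split; last by ord O.
  by move=> e; apply: n1; apply: (hull_eqv_between e); ord O.
have ltP x y : lt' x y -> prec x y \/ hull_eqv x y.
  by move=> h; have [|n] := pselect (hull_eqv x y); [right|left; split=> //; apply/hull_eqvN].
have precF x y : prec x y -> flip x y by move=> [n h]; right.
have rfl := hull_eqv_refl; have sym := hull_eqv_sym.
move=> [m [C [cC ->]]]; apply: fcu_bigcup => i.
have [_ {cC}] := cC i; move: {C i}(C i) => C cC.
have mid x y z : hull_eqv x z -> C x -> C z -> lt' x y -> lt' y z ->
    C y /\ hull_eqv x y.
  move=> e Cx Cz xy yz.
  have exy : hull_eqv x y.
    case: (ltP _ _ xy) => // pxy; case: (ltP _ _ yz) => [pyz|eyz].
      by case: (precT _ _ _ pxy pyz).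
    exact: hull_eqv_trans e (sym _ _ eyz).
  split=> //; apply: (cC z y x) => //; left; split=> //; last exact: sym.
  exact: hull_eqv_trans (sym _ _ e) exy.
have ltE x z : ~ prec x z -> ~ prec z x -> hull_eqv x z.
  move=> n1 n2; apply: contrapT => n; case: (lo_tot O x z) => h.
  - by apply: n1.
  - by apply: n; rewrite h.
  - by apply: n2; split=> // /sym.
suff -> : C = [set x | C x /\ forall u, C u -> ~ prec u x]
   `|` ([set x | C x /\ forall u, C u -> ~ prec x u]
   `|` [set x | C x /\ exists u v, [/\ C u, C v, prec u x & prec x v]]).
  apply: fcuU; [|apply: fcuU]; apply: fcu_convex; split=> //.
  - move=> x y z [Cx hx] _ [Cz hz] xy yz.
    have e : hull_eqv x z by apply: ltE; [exact: hz|exact: hx].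
    have [Cy exy] := mid _ _ _ e Cx Cz xy yz.
    by split=> // u Cu p; apply: (hx u) => //; apply: precE p => //; exact: sym.
  - move=> x y z [Cx hx] _ [Cz hz] xy yz.
    have e : hull_eqv x z by apply: ltE; [exact: hx|exact: hz].
    have [Cy exy] := mid _ _ _ e Cx Cz xy yz.
    by split=> // u Cu p; apply: (hx u) => //; apply: precE p => //; exact: sym.
  - move=> x y z [Cx [u [_ [Cu _ pux _]]]] _ [Cz [_ [v [_ Cv _ pzv]]]] xy yz.
    have puy : prec u y.
      by case: (ltP _ _ xy) => h; [apply: precT h|apply: precE pux].
    have pyv : prec y v.
      by case: (ltP _ _ yz) => h; [apply: precT pzv|apply: precE pzv => //; exact: sym].
    split; last by exists u, v.
    by apply: (cC u y v) => //; exact: precF.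
rewrite predeqE => x; split=> [Cx|[[]|[[]|[]]]//].
have [[u [Cu pu]]|no] := pselect (exists u, C u /\ prec u x); last first.
  by left; split=> // u Cu p; apply: no; exists u.
have [[v [Cv pv]]|no] := pselect (exists u, C u /\ prec x u); last first.
  by right; left; split=> // v Cv p; apply: no; exists v.
by right; right; split=> //; exists u, v.
Qed.

End TwoOrders.

(* By induction on the number of changes between agreement and disagreement of
   the two orders to the right of a point: flipping [lt'] inside the classes of
   [hull_eqv] merges the last two of the alternating blocks. *)
Lemma fcu_two_orders (U : Type) (lt lt' : U -> U -> Prop) :
  linear_order_on [set: U] lt -> linear_order_on [set: U] lt' ->
  transitive_autos lt lt' ->
  (forall a, finite_convex_union setT lt [set x | lt' a x]) ->
  forall X, finite_convex_union setT lt X -> finite_convex_union setT lt' X.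
Proof.
move=> O O' G fin X fX.
have [[a0]|no] := pselect (inhabited U); last first.
  by apply: fcu_convex; split=> // x; case: no.
have [k bk] : exists k, bounded_changes lt lt' k.
  have [n hn] := fcu_alt O (fin a0).
  exists n => a y; have [s [ss s1 s2 sa]] := G a a0.
  have sA P Q m : alt lt P Q m y -> alt lt (s @` P) (s @` Q) m (s y).
    by apply: alt_transport => [x z|x Px|x Qx]; [move/s1|exists x|exists x].
  have h := hn (s @` agree lt lt' a) (s @` disagree lt lt' a) n (s y).
  have [||h1 h2] := h _ _ (leqnn n).
  - by move=> _ [x [_ ax] <-] /=; rewrite -sa; apply/s2.
  - by move=> _ [x [_ xa] <-]; split=> //=; rewrite -sa => /s2; apply: (lo_asym O').
  by split=> /sA.
elim: k lt' O' G fin bk => [|k IH] lt' O' G fin bk.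
  have single (x y : U) : x = y.
    apply: contrapT => n.
    have H u v : lt u v -> False.
      move=> uv; case: (lo_tot O' u v) => h.
      - by apply: (bk u v).1; apply: alt0 => //; apply: (lo_irr O).
      - by subst v; exact: (lo_irr O uv).
      - by apply: (bk u v).2; apply: alt0 => //; apply: (lo_irr O).
    by case: (lo_tot O x y) => // /H.
  by apply: fcu_convex; split=> // x y z Xx _ _ _ _; rewrite (single y x).
have main lt1 : linear_order_on [set: U] lt1 -> transitive_autos lt lt1 ->
    (forall a, finite_convex_union setT lt [set x | lt1 a x]) ->
    bounded_changes lt lt1 k.+1 ->
    (exists a y, lt a y /\ forall z, ~ lt z y -> lt1 a z) ->
    finite_convex_union setT lt1 X.
  move=> O1 G1 fin1 bk1 [a [y [ay hy]]].
  have pos b : exists y, lt b y /\ forall z, ~ lt z y -> lt1 b z.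
    have [s [ss s1 s2 <-]] := G1 a b.
    exists (s y); split; first exact/s1.
    move=> z; have [z' <-] := ss z => h; apply/s2; apply: hy => h'; apply: h.
    exact/s1.
  have [[c [w dw]]|no] := pselect (exists c w, disagree lt lt1 c w).
    apply: (fcu_unflip O O1 G1 fin1 bk1).
    apply: IH; [exact: flip_order bk1|exact: flip_autos|exact: fcu_flip bk1|].
    apply: flip_changes => // b.
    have [s [ss s1 s2 <-]] := G1 c b.
    by exists (s w); apply/disagree_auto.
  suff -> : lt1 = lt by [].
  apply/funext => u; apply/funext => v; apply/propext.
  have H u' v' : lt u' v' -> lt1 u' v'.
    move=> uv; apply: contrapT => /(lo_nlt O1) [e|h]; last first.
      by apply: no; exists u', v'.
    by subst v'; exact: (lo_irr O uv).
  split; last exact: H.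
  move=> h; apply: contrapT => /(lo_nlt O) [e|/H h'].
    by subst v; exact: (lo_irr O1 h).
  exact: (lo_asym O1 h).
(* Either the orders eventually agree above some point, or they eventually disagree, which reduces
   to the first case by reversing [lt']. If neither happens and there are points above [a0],
   agreement and disagreement alternate without bound. *)
have [pos|npos] := pselect (exists a y, lt a y /\ forall z, ~ lt z y -> lt' a z).
  exact: main.
have [neg|nneg] := pselect (exists a y, lt a y /\ forall z, ~ lt z y -> lt' z a).
  suff : finite_convex_union setT (fun x y => lt' y x) X by move/fcu_rev.
  apply: main => //.
  - exact: lo_rev.
  - by move=> a b; have [s [ss s1 s2 sa]] := G a b; exists s.
  - move=> a.
    have c1 : convex_in setT lt [set a].
      by split=> // x y z /= -> _ -> *; exfalso; ord O.
    suff -> : [set x | lt' x a] = setT `\` ([set x | lt' a x] `|` [set a]).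
      by apply: (fcuC O); apply: fcuU => //; exact: fcu_convex.
    rewrite predeqE => x; split=> [h|[_ h]].
      split=> // -[|/= e]; first exact: (lo_asym O').
      by subst x; exact: (lo_irr O' h).
    by apply: contrapT => /(lo_nlt O') [e|e]; apply: h; [right|left].
  - by move=> a y; case: (bk a y).
have [[y ay]|no] := pselect (exists y, lt a0 y); last first.
  have single (x y : U) : x = y.
    have H u v : ~ lt u v.
      have [s [ss s1 s2 <-]] := G a0 u.
      by have [v' <-] := ss v => /s1 h; apply: no; exists v'.
    by apply: (lo_anti O); exact: H.
  by apply: fcu_convex; split=> // x u z Xx _ _ _ _; rewrite (single u x).
exfalso.
have PN x : lt a0 x -> exists2 z, agree lt lt' a0 z & ~ lt z x.
  move=> ax; apply: contrapT => no; apply: nneg; exists a0, x; split=> // z xz.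
  apply: contrapT => /(lo_nlt O') [e|h]; first by subst z; apply: xz.
  by apply: no; exists z => //; split=> //; ord O.
have NP x : lt a0 x -> exists2 z, disagree lt lt' a0 z & ~ lt z x.
  move=> ax; apply: contrapT => no; apply: npos; exists a0, x; split=> // z xz.
  apply: contrapT => /(lo_nlt O') [e|h]; first by subst z; apply: xz.
  by apply: no; exists z => //; split=> //; ord O.
have [w dw _] := NP _ ay.
have [z h] : exists z, alt lt (disagree lt lt' a0) (agree lt lt' a0) k.+1 z.
  by apply: (alt_unbounded O dw) => x [ax _]; [exact: PN|exact: NP].
exact: (bk a0 z).2 h.
Qed.

(** * Definability *)

Section Semantics.
Variables (L : signature) (M : structure L).

Lemma eval_rename (V W : Type) (g : V -> W) (v : W -> M) (t : term L V) :
  eval v (term_rename g t) = eval (v \o g) t.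
Proof.
by elim: t => //= f ts IH; congr fint; apply/funext => i; apply: IH.
Qed.

Lemma sat_rename (V W : Type) (g : V -> W) (v : W -> M) (phi : formula L V) :
  sat v (rename g phi) <-> sat (v \o g) phi.
Proof.
elim: phi W g v => {V} [V|V t u|V r ts|V phi IH1 psi IH2|V psi IH] W g v //=.
- by rewrite !eval_rename.
- suff -> : (fun i => eval v (term_rename g (ts i))) = (fun i => eval (v \o g) (ts i)) by [].
  by apply/funext => i; exact: eval_rename.
- by split=> h /IH1 /h /IH2.
- suff E a : (fun o => oapp v a o) \o omap g = (fun o => oapp (v \o g) a o).
    by split=> h a; have := h a; rewrite IH E.
  by apply/funext => -[].
Qed.

Lemma sat_auto (s : M -> M) (V : Type) (v : V -> M) (phi : formula L V) :
  automorphism s -> (sat (s \o v) phi <-> sat v phi).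
Proof.
move=> [[s' sK s'K] hf hr].
have ev W (w : W -> M) (t : term L W) : eval (s \o w) t = s (eval w t).
  elim: t => //= f ts IH; rewrite hf; congr fint.
  by apply/funext => i; apply: IH.
elim: phi v => {V} [V|V t u|V r ts|V phi IH1 psi IH2|V psi IH] v //=.
- by rewrite !ev; split=> [/(can_inj sK)|->].
- rewrite (hr _ (fun i => eval v (ts i))).
  suff -> : (fun i => eval (s \o v) (ts i)) = s \o (fun i => eval v (ts i)) by [].
  by apply/funext => i; exact: ev.
- by split=> h /IH1 /h /IH2.
- have E a : (fun o => oapp (s \o v) (s a) o) = s \o (fun o => oapp v a o).
    by apply/funext => -[].
  split=> h a.
    by rewrite -IH -E; exact: h.
  by rewrite -(s'K a) E IH.
Qed.

(** This serves to cut the parameters of a definable relation down to finitely many, in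
    [dfn2_finite]. *)
Lemma sat_support (V : Type) (phi : formula L V) :
  exists2 F : set V, finite_set F &
    forall v v' : V -> M, (forall x, F x -> v x = v' x) ->
      (sat v phi <-> sat v' phi).
Proof.
have ev W (t : term L W) : exists F : set W, finite_set F /\
    forall v v' : W -> M, (forall x, F x -> v x = v' x) -> eval v t = eval v' t.
  elim: t => [x|f ts IH].
    by exists [set x]; split=> // v v' h /=; apply: h.
  have [F hF] := choice IH.
  exists (\bigcup_i F i); split.
    by apply: bigcup_finite => [|i _]; [exact: finite_finset|case: (hF i)].
  move=> v v' h /=; congr fint; apply/funext => i.
  by apply: (hF i).2 => x Fx; apply: h; exists i.
elim: phi => {V} [V|V t u|V r ts|V phi [F1 f1 h1] psi [F2 f2 h2]|V psi [F f h]].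
- by exists set0.
- have [F [fF hF]] := ev _ t; have [F' [fF' hF']] := ev _ u.
  exists (F `|` F'); first by rewrite finite_setU.
  move=> v v' h /=; rewrite (hF v v') ?(hF' v v') // => x Fx; apply: h; by [left|right].
- have [F hF] := choice (fun i => ev _ (ts i)).
  exists (\bigcup_i F i).
    by apply: bigcup_finite => [|i _]; [exact: finite_finset|case: (hF i)].
  move=> v v' h /=.
  suff -> : (fun i => eval v (ts i)) = (fun i => eval v' (ts i)) by [].
  by apply/funext => i; apply: (hF i).2 => x Fx; apply: h; exists i.
- exists (F1 `|` F2); first by rewrite finite_setU.
  move=> v v' h /=.
  rewrite (h1 v v') ?(h2 v v') // => x Fx; apply: h; by [left|right].
- exists (Some @^-1` F).
    have : Some @^-1` F #<= F by apply: card_ge_preimage => x y _ _ [].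
    by move/card_le_finite; apply.
  move=> v v' e /=; split=> hs a.
    by rewrite -(h (fun o => oapp v a o)) // => -[x|] //= Fx; apply: e.
  by rewrite (h _ (fun o => oapp v' a o)) // => -[x|] //= Fx; apply: e.
Qed.

Definition valA (A : set M) (v : nat -> M) (w : nat + {a | A a}) : M :=
  match w with inl i => v i | inr a => proj1_sig a end.

(* Definability over [A] of a relation on finitely many of the coordinates of
   [v : nat -> M]; coordinates act as de Bruijn indices. *)
Definition dfn (A : set M) (P : (nat -> M) -> Prop) :=
  exists phi : formula L (nat + {a | A a}), forall v, P v <-> sat (valA v) phi.

Definition dfn1 A (X : set M) := dfn A (fun v => X (v 0%N)).
Definition dfn2 A (R : M -> M -> Prop) := dfn A (fun v => R (v 0%N) (v 1%N)).

Definition dterm (A : set M) (t : (nat -> M) -> M) :=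
  exists w : nat + {a | A a}, forall v, t v = valA v w.

Section Closure.
Variable A : set M.

Lemma dfn_imp P Q : dfn A P -> dfn A Q -> dfn A (fun v => P v -> Q v).
Proof.
move=> [phi h1] [psi h2]; exists (Imp phi psi) => v.
by split=> /= h; [move=> /h1 /h /h2|move=> p; apply/h2/h/h1].
Qed.

Lemma dfn_false : dfn A (fun=> False).
Proof. by exists Fal => v; split. Qed.

Lemma dfn_iff P Q : (forall v, P v <-> Q v) -> dfn A P -> dfn A Q.
Proof. by move=> PQ [phi h]; exists phi => v; rewrite -PQ. Qed.

Lemma dfn_not P : dfn A P -> dfn A (fun v => ~ P v).
Proof. by move=> h; apply: dfn_imp => //; exact: dfn_false. Qed.

Lemma dfn_true : dfn A (fun=> True).
Proof. by apply: dfn_iff (dfn_not dfn_false) => v; tauto. Qed.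

Lemma dfn_and P Q : dfn A P -> dfn A Q -> dfn A (fun v => P v /\ Q v).
Proof.
move=> h1 h2; apply: dfn_iff (dfn_not (dfn_imp h1 (dfn_not h2))) => v.
by split=> [|[]]; [move=> h; apply: contrapT; tauto|tauto].
Qed.

Lemma dfn_or P Q : dfn A P -> dfn A Q -> dfn A (fun v => P v \/ Q v).
Proof.
move=> h1 h2; apply: dfn_iff (dfn_imp (dfn_not h1) h2) => v.
by split=> [h|[]]; [apply: contrapT|tauto|tauto]; tauto.
Qed.

Lemma dfn_equiv P Q : dfn A P -> dfn A Q -> dfn A (fun v => P v <-> Q v).
Proof. by move=> h1 h2; apply: dfn_and; apply: dfn_imp. Qed.

Lemma dfn_all (Q : M -> (nat -> M) -> Prop) :
  dfn A (fun v => Q (v 0%N) (fun n => v n.+1)) -> dfn A (fun v => forall x, Q x v).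
Proof.
move=> [phi h].
(* Coordinate [0] becomes the bound variable and the other coordinates shift down by one. *)
pose g (w : nat + {a | A a}) : option (nat + {a | A a}) :=
  match w with inl 0 => None | inl n.+1 => Some (inl n) | inr a => Some (inr a) end.
exists (All (rename g phi)) => v /=.
have E x : (fun o => oapp (valA v) x o) \o g =
    valA (fun n => if n is m.+1 then v m else x).
  by apply/funext => -[[|n]|a].
by split=> hv x; have := hv x; rewrite sat_rename E -h.
Qed.

Lemma dfn_ex (Q : M -> (nat -> M) -> Prop) :
  dfn A (fun v => Q (v 0%N) (fun n => v n.+1)) ->
  dfn A (fun v => exists x, Q x v).
Proof.
move=> /dfn_not h.
apply: dfn_iff (dfn_not (dfn_all (Q := fun x v => ~ Q x v) h)) => v.
split=> [|[x Qx]]; last by move=> n; exact: n Qx.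
by move=> n; apply: contrapT => n'; apply: n => x Qx; apply: n'; exists x.
Qed.

Lemma dfn_ex2 (P Q : M -> (nat -> M) -> Prop) :
  dfn A (fun v => P (v 0%N) (fun n => v n.+1)) ->
  dfn A (fun v => Q (v 0%N) (fun n => v n.+1)) ->
  dfn A (fun v => exists2 x, P x v & Q x v).
Proof.
move=> h1 h2.
apply: dfn_iff (dfn_ex (Q := fun x v => P x v /\ Q x v) (dfn_and h1 h2)) => v.
by split=> -[x]; [case; exists x|exists x].
Qed.

Lemma dfn_subst P (t : nat -> (nat -> M) -> M) :
  (forall n, dterm A (t n)) -> dfn A P -> dfn A (fun v => P (fun n => t n v)).
Proof.
move=> /choice [g hg] [phi h].
exists (rename (fun w => match w with inl n => g n | inr a => inr a end) phi) => v.
rewrite sat_rename h.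
suff -> : valA (t ^~ v) = valA v \o
    (fun w => match w with inl n => g n | inr a => inr a end) by [].
by apply/funext => -[n|a] //=.
Qed.

Lemma dterm_var i : dterm A (fun v => v i).
Proof. by exists (inl i). Qed.

Lemma dterm_par a : A a -> dterm A (fun=> a).
Proof. by move=> Aa; exists (inr (exist A a Aa)). Qed.

Lemma dfn1_at X t : dfn1 A X -> dterm A t -> dfn A (fun v => X (t v)).
Proof. by move=> h ht; apply: (dfn_subst (t := fun=> t)) h => n. Qed.

Lemma dfn2_at R s t : dfn2 A R -> dterm A s -> dterm A t ->
  dfn A (fun v => R (s v) (t v)).
Proof.
move=> h hs ht; apply: (dfn_subst (t := fun n => if n is 0 then s else t)) h.
by case.
Qed.

Lemma dfn2_eq : dfn2 A eq.
Proof. by exists (Eql (Var L (inl 0%N)) (Var L (inl 1%N))) => v; split. Qed.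

Lemma dfn_mono A' P : A `<=` A' -> dfn A P -> dfn A' P.
Proof.
move=> AA' [phi h].
exists (rename (fun w => match w with inl n => inl n
   | inr a => inr (exist A' (proj1_sig a) (AA' _ (proj2_sig a))) end) phi) => v.
rewrite sat_rename h.
match goal with |- sat ?f phi <-> sat ?g phi => suff -> : f = g by [] end.
by apply/funext => -[].
Qed.

End Closure.

Lemma dfn_auto A P s v : dfn A P -> automorphism s -> (forall a, A a -> s a = a) ->
  (P (s \o v) <-> P v).
Proof.
move=> [phi h] hs sA; rewrite !h.
suff -> : valA (A := A) (s \o v) = s \o valA v by exact: sat_auto.
by apply/funext => -[n|[a Aa]] //=; rewrite sA.
Qed.

Lemma dfn1_auto A X s x : dfn1 A X -> automorphism s ->
  (forall a, A a -> s a = a) -> (X (s x) <-> X x).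
Proof. by move=> h hs sA; exact: (dfn_auto (fun=> x) h hs sA). Qed.

Lemma dfn2_auto A R s x y : dfn2 A R -> automorphism s ->
  (forall a, A a -> s a = a) -> (R (s x) (s y) <-> R x y).
Proof.
by move=> h hs sA; exact: (dfn_auto (fun n => if n is 0 then x else y) h hs sA).
Qed.

Definition fdef (A : set M) (phi : formulaA A 1) : set M :=
  [set a | satA phi (fun=> a)].

Lemma dfn1_fdef A (phi : formulaA A 1) : dfn1 A (fdef phi).
Proof.
exists (rename (fun w => match w with inl _ => inl 0%N | inr a => inr a end) phi).
move=> v; rewrite sat_rename.
match goal with |- _ <-> sat ?f phi => suff -> : f =
  (fun w : 'I_1 + {a | A a} => match w with inl _ => v 0%N | inr a => proj1_sig a end) by [] end.
by apply/funext => -[].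
Qed.

Lemma fdef_dfn1 A X : dfn1 A X -> exists phi : formulaA A 1, fdef phi = X.
Proof.
move=> [phi h].
exists (rename (fun w => match w with inl _ => inl ord0 | inr a => inr a end) phi).
rewrite predeqE => a; rewrite /fdef /satA /= sat_rename.
match goal with |- sat ?f phi <-> _ => suff -> : f = valA (fun=> a) by rewrite -h end.
by apply/funext => -[].
Qed.

Lemma rel_definable1P D A X :
  rel_definable1 D A X <-> exists2 X', dfn1 A X' & X = X' `&` D.
Proof.
split=> [[phi e]|[X' h ->]].
  exists (fdef phi); first exact: dfn1_fdef.
  rewrite predeqE => a; move: e; rewrite predeqE => /(_ (fun=> a)) /= ->.
  by split=> -[h1 h2]; split=> // ; exact: h2 ord0.
have [phi e] := fdef_dfn1 h; exists phi; rewrite -e predeqE => x /=.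
have E : (fun=> x ord0) = x by apply/funext => i; rewrite (ord1 i).
split=> -[h1 h2]; split.
- by move: h1; rewrite /fdef /= E.
- by move=> i; rewrite (ord1 i).
- by rewrite /fdef /= E.
- exact: h2.
Qed.

Lemma definable1P A X : definable1 A X <-> dfn1 A X.
Proof.
rewrite /definable1 rel_definable1P; split=> [[X' h ->]|h]; first by rewrite setIT.
by exists X => //; rewrite setIT.
Qed.

Lemma rel_definable2P D A R : rel_definable2 D A R <->
  exists2 R', dfn2 A R' & forall x y, D x -> D y -> (R x y <-> R' x y).
Proof.
split=> [[phi e]|[R' [phi h] e]].
  pose f (x y : M) (i : 'I_2) := if i == ord0 then x else y.
  exists (fun x y => satA phi (f x y)).
    exists (rename (fun w => match w with
      | inl i => inl (if i == ord0 then 0%N else 1%N) | inr a => inr a end) phi) => v.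
    rewrite sat_rename /satA.
    match goal with |- sat ?f phi <-> sat ?g phi => suff -> : f = g by [] end.
    by apply/funext => -[i|//] /=; rewrite /f; case: eqP.
  move=> x y Dx Dy; move: e; rewrite predeqE => /(_ (f x y)) /=.
  rewrite /f /= => e; split=> [h|h]; first by have [] := e.1 (And3 Dx Dy h).
  have [] // := e.2 (conj h _) => i; by case: eqP.
exists (rename (fun w => match w with
   | inl n => inl (if n is 0 then ord0 else ord_max) | inr a => inr a end) phi).
rewrite predeqE => x /=; rewrite /satA sat_rename.
match goal with |- _ <-> sat ?f phi /\ _ => suff -> : f =
  valA (fun n => if n is 0 then x ord0 else x ord_max) end; last first.
  by apply/funext => -[[]|].
rewrite -h; split=> [[D0 D1 /e h']|[h1 h2]].
  split; first exact: h'.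
  move=> i; suff [->|->] : i = ord0 \/ i = ord_max by [].
  by case: i => [[|[|//]] hi]; [left|right]; apply: val_inj.
by split=> //; apply/e.
Qed.

Lemma definable2P A R : definable2 A R <-> dfn2 A R.
Proof.
rewrite /definable2 rel_definable2P; split=> [[R' h e]|h]; last by exists R.
by apply: dfn_iff h => v; rewrite e.
Qed.

End Semantics.

Ltac dfn_step :=
  first
  [ apply: dfn_true | apply: dfn_false
  | apply: dfn_and | apply: dfn_or | apply: dfn_equiv
  | (apply: dfn_ex; cbv beta) | (apply: dfn_ex2; cbv beta)
  | apply: dfn_not | apply: dfn_imp | (apply: dfn_all; cbv beta)
  | lazymatch goal with
    | |- dfn _ (fun v => @?s v = @?t v) => apply: (dfn2_at (R := eq) (s := s) (t := t));
         [exact: dfn2_eq| |]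
    | |- dfn _ (fun v => ?R (@?s v) (@?t v)) => apply: (dfn2_at (R := R) (s := s) (t := t));
         [try assumption| |]
    | |- dfn _ (fun v => ?X (@?s v)) => apply: (dfn1_at (X := X) (t := s)); [try assumption|]
    | |- dterm _ _ => first [apply: dterm_var | apply: dterm_par; try assumption]
    end ].

Ltac dfn := rewrite ?/dfn1 ?/dfn2; repeat dfn_step.

(** * Loci of complete types in the monster model *)

Lemma inj_card_leP (T U : Type) (A : set T) (B : set U) (f : T -> U) :
  set_fun A B f -> set_inj A f -> A #<= B.
Proof.
move=> h1 h2; have [g] : $|{injfun A >-> B}| by apply/injfunPex; exists f.
exact: inj_card_le g.
Qed.

Lemma infinite_injection (T : Type) (A : set T) : infinite_set A ->
  exists2 f : nat -> T, forall n, A (f n) & injective f.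
Proof.
move=> /infiniteP /card_leP [f].
exists (fun n => set_val (f (SigSub (mem_set (I : [set: nat] n))))) => [n|m n].
  by apply: set_mem; exact: valP.
move=> /val_inj e.
by have := @inj _ _ _ f _ _ (mem_set I) (mem_set I) e; case.
Qed.

Section Locus.
Variables (K : Type) (L : signature) (M : structure L).
Hypothesis small_language : small_set K [set: formula L nat].
Hypothesis Msat : saturated K M.
Hypothesis Mhom : strongly_homogeneous K M.

Lemma small_finite (A : set M) : finite_set A -> small_set K A.
Proof.
move=> /finite_set_countable fA h; apply: small_language.
apply: (card_le_trans h); apply: (card_le_trans fA).
by apply: (@inj_card_leP _ _ _ _ (fun n => Eql (Var L n) (Var L n))) => // m n _ _ [].
Qed.

Lemma small_setU1 (A : set M) a : small_set K A -> small_set K (A `|` [set a]).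
Proof.
move=> sA h; have [fA|iA] := pselect (finite_set A).
  by apply: (small_finite _ h); rewrite finite_setU; split=> //; exact: finite_set1.
apply: sA; apply: (card_le_trans h).
have [Aa|nAa] := pselect (A a).
  by apply: subset_card_le => x [|->].
have [f fA finj] := infinite_injection iA.
(* Hilbert's hotel: [a] is sent to [f 0] and each [f n] to [f n.+1]. *)
pose g x := if pselect (x = a) then f 0%N else
  if pselect (exists n, f n = x) is left e then f (projT1 (cid e)).+1 else x.
have gP x : [\/ x = a /\ g x = f 0%N, exists2 n, f n = x & g x = f n.+1 |
    (forall n, f n <> x) /\ g x = x].
  rewrite /g; case: (pselect (x = a)) => ?; first by constructor 1.
  case: (pselect (exists n, f n = x)) => [e|e]; [constructor 2|constructor 3].
    by exists (projT1 (cid e)) => //; exact: projT2 (cid e).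
  by split=> // n fn; apply: e; exists n.
apply: (@inj_card_leP _ _ _ _ g) => [x Ax|x y _ _].
  case: (gP x) => [[_ ->]|[n _ ->]|[_ e]]; [exact: fA|exact: fA|rewrite e].
  case: Ax => // xa; move: e; rewrite /g; case: (pselect (x = a)) => // ? <-.
  exact: fA.
case: (gP x) => [[-> ->]|[n <- ->]|[hx ->]];
  case: (gP y) => [[-> ->]|[m <- ->]|[hy ->]] //.
- by move=> /finj.
- by move=> e; case: (hy _ e).
- by move=> /finj.
- by move=> /finj [->].
- by move=> e; case: (hy _ e).
- by move=> e; case: (hx _ (esym e)).
- by move=> e; case: (hx _ (esym e)).
Qed.

(** By directedness any finitely many members of [F] contain a common nonempty member, so the
    corresponding set of formulas is finitely satisfiable. *)
Lemma saturated_directed (C : set M) (F : set (set M)) X0 :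
  small_set K C -> F X0 -> (forall X, F X -> dfn1 C X) ->
  (forall X, F X -> exists x, X x) ->
  (forall X Y, F X -> F Y -> exists2 Z, F Z & Z `<=` X `&` Y) ->
  exists x, forall X, F X -> X x.
Proof.
move=> sC FX0 Fd Fn FI.
have [q qp fq|x hx] := @Msat C sC [set phi | F (fdef phi)].
  suff [Z /Fn [x Zx] Zq] : exists2 Z, F Z & forall phi, q phi -> Z `<=` fdef phi.
    by exists (fun=> x) => phi /Zq; apply.
  have [n hn] := (finite_setP q).1 fq.
  elim: n q qp {fq} hn => [|n IH] q qp.
    rewrite II0 card_eq0 => /eqP q0; exists X0 => // phi.
    by rewrite q0.
  move=> /eq_cardSP [phi qphi] /IH [|Z FZ hZ].
    by move=> psi [/qp].
  have [Z' FZ' hZ'] := FI _ _ FZ (qp _ qphi).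
  exists Z' => // psi qpsi.
  have [->|ne] := pselect (psi = phi); first by move=> x /hZ' [].
  by apply: subset_trans (hZ psi _) => [x /hZ' []|] //; split.
exists x => X FX; have [phi e] := fdef_dfn1 (Fd _ FX).
by rewrite -e; apply: hx; rewrite /= e.
Qed.

Definition fixes (B : set M) (s : M -> M) :=
  automorphism s /\ forall a, B a -> s a = a.

Lemma fixes_inv B s : fixes B s ->
  exists s', [/\ fixes B s', cancel s s' & cancel s' s].
Proof.
move=> [[[s' sK s'K] hf hr] sB]; exists s'; split=> //; split.
  split; first by exists s.
    move=> f x; apply: (can_inj sK); rewrite s'K hf.
    by congr fint; apply/funext => i /=; rewrite s'K.
  move=> r x; rewrite (hr r (s' \o x)).
  suff -> : s \o (s' \o x) = x by [].
  by apply/funext => i /=; rewrite s'K.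
by move=> a Ba; apply: (can_inj sK); rewrite s'K sB.
Qed.

(* [D] is the set of realizations of a complete type over [B]. *)
Definition locus (B D : set M) :=
  (forall X a b, dfn1 B X -> D a -> D b -> X a -> X b) /\
  (forall x, (forall X, dfn1 B X -> D `<=` X -> X x) -> D x).

Lemma locus_realizations B (p : set (formulaA B 1)) :
  complete_types B 1 p -> locus B (realizations p).
Proof.
move=> [_ cp]; split=> [X a b dX Da Db|x h].
  have [phi <-] := fdef_dfn1 dX => Xa.
  have [/Db//|/Da] := cp phi.
  by rewrite /satA /= => /(_ Xa).
by move=> phi pphi; apply: (h (fdef phi) (dfn1_fdef phi)) => a; apply.
Qed.

Section Fixed.
Variables B D : set M.
Hypothesis sB : small_set K B.
Hypothesis lD : locus B D.

Lemma locus_auto s x : fixes B s -> (D (s x) <-> D x).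
Proof.
move=> [hs sB']; case: lD => _ h2.
split=> Dx; apply: h2 => X dX DX.
  by apply/(dfn1_auto _ dX hs sB'); apply: DX.
by apply/(dfn1_auto _ dX hs sB'); apply: DX.
Qed.

(** Since [a] and [b] have the same type over [B], the map fixing [B] and sending [a] to [b] is
    elementary; strong homogeneity extends it. *)
Lemma locus_trans a b : D a -> D b -> exists2 s, fixes B s & s a = b.
Proof.
move=> Da Db; have [h1 _] := lD.
have eq1 X : dfn1 B X -> (X a <-> X b).
  by move=> dX; split; apply: h1.
pose f x := if pselect (x = a) then b else x.
have fB x : B x -> f x = x.
  move=> Bx; rewrite /f; case: pselect => // e.
  have dX : dfn1 B [set y | x = y] by rewrite /dfn1 /=; dfn.
  exact/esym/(h1 _ a b dX).
have fa : f a = b by rewrite /f; case: pselect.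
have [|s hs sf] := Mhom (small_setU1 (a := a) sB) (f := f).
  move=> n phi x hx.
  (* The arguments equal to [a] become the free variable, the others are parameters from [B]. *)
  have /choice [g hg] : forall i, exists w : nat + {c | B c}, forall y,
      (if pselect (x i = a) then y else x i) = valA (fun=> y) w.
    move=> i; case: pselect => [e|ne]; first by exists (inl 0%N).
    by case: (hx i) => // Bx; exists (inr (exist B (x i) Bx)).
  pose X y := sat (fun i => if pselect (x i = a) then y else x i) phi.
  have dX : dfn1 B X.
    exists (rename (fun i => match g i with inl _ => inl 0%N | inr c => inr c end) phi).
    move=> v; rewrite sat_rename /X.
    match goal with |- sat ?f phi <-> sat ?g phi => suff -> : f = g by [] end.
    by apply/funext => i; rewrite hg /=; case: (g i).
  have -> : x = (fun i => if pselect (x i = a) then a else x i).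
    by apply/funext => i; case: pselect.
  rewrite -/(X a) (eq1 _ dX) /X.
  match goal with |- sat ?f phi <-> sat ?g phi => suff -> : f = g by [] end.
  by apply/funext => i /=; rewrite /f; case: (pselect (x i = a)) => //= h;
    case: pselect.
exists s; last by rewrite sf ?fa //; right.
by split=> // c Bc; rewrite sf ?fB //; left.
Qed.

(** A filter base with intersection [D]; compactness arguments pass to [D] along it. *)
Definition nbd (X : set M) := dfn1 B X /\ D `<=` X.

Lemma nbdI X Y : nbd X -> nbd Y -> nbd (X `&` Y).
Proof.
move=> [h1 h2] [h3 h4]; split; first exact: dfn_and h1 h3.
by move=> x Dx; split; [apply: h2|apply: h4].
Qed.

Lemma nbdT : nbd setT.
Proof. by split=> //; exact: dfn_true. Qed.

(** Monotonicity of [Y] makes the sets of points common to [X] and [Y X] a directed family, to which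
    saturation applies. *)
Lemma locus_compact (C : set M) (Y : set M -> set M) :
  small_set K C -> B `<=` C ->
  (forall X, nbd X -> dfn1 C (Y X)) ->
  (forall X X', X `<=` X' -> Y X `<=` Y X') ->
  (forall X, nbd X -> exists2 x, X x & Y X x) ->
  exists2 x, D x & forall X, nbd X -> Y X x.
Proof.
move=> sC BC Yd Ym Yn.
pose F := [set Z | exists2 X, nbd X & Z = X `&` Y X].
have FT : F (setT `&` Y setT) by exists setT => //; exact: nbdT.
have [|||x hx] := saturated_directed sC FT.
- move=> _ [X nX ->]; apply: dfn_and; last exact: Yd.
  by apply: dfn_mono BC _; case: nX.
- by move=> _ [X nX ->]; have [x] := Yn _ nX; exists x.
- move=> _ _ [X nX ->] [X' nX' ->]; exists ((X `&` X') `&` Y (X `&` X')).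
    by exists (X `&` X') => //; exact: nbdI.
  move=> x [[Xx X'x] h]; split; split=> //; apply: Ym h => y [] //.
have H X : nbd X -> X x /\ Y X x by move=> nX; apply: (hx (X `&` Y X)); exists X.
exists x => [|X /H[]//].
case: lD => _; apply=> X dX DX.
by have [] := H X (conj dX DX).
Qed.

End Fixed.

(** [fcu_two_orders] is about orders on a whole type, so [D] has to be exchanged for a subtype. *)
Lemma fcu_sig (D : set M) lt X :
  finite_convex_union [set: {x | D x}] (fun u v => lt (sval u) (sval v))
    [set u | X (sval u)] <-> finite_convex_union D lt (X `&` D).
Proof.
split=> -[m [C [cC e]]].
  exists m, (fun i => sval @` C i); split.
    move=> i; have [_ h] := cC i; split; first by move=> _ [[x Dx] _ <-].
    move=> _ y _ [u Cu <-] Dy [w Cw <-] uy yw.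
    by exists (exist D y Dy) => //; apply: (h u _ w).
  rewrite predeqE => x; split=> [[Xx Dx]|[i _ [[y Dy] Cy <-]]].
    have : [set u : {x | D x} | X (sval u)] (exist D x Dx) by [].
    by rewrite e => -[i _ Ci]; exists i => //; exists (exist D x Dx).
  split=> //; have : (\bigcup_i C i) (exist D y Dy) by exists i.
  by rewrite -e.
exists m, (fun i => [set u | C i (sval u)]); split.
  move=> i; have [_ h] := cC i; split=> // -[x Dx] [y Dy] [z Dz] /=.
  by move=> Cx _ Cz; apply: h.
rewrite predeqE => -[x Dx]; split=> [Xx|[i _ Ci]].
  have : (X `&` D) x by [].
  by rewrite e => -[i _ Ci]; exists i.
have : (\bigcup_i C i) x by exists i.
by rewrite -e => -[].
Qed.

Lemma fcu_eq_order (D : set M) lt lt' X :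
  (forall x y, D x -> D y -> (lt x y <-> lt' x y)) ->
  finite_convex_union D lt X -> finite_convex_union D lt' X.
Proof.
move=> e [m [C [cC ->]]]; exists m, C; split=> // i.
have [CD h] := cC i; split=> // x y z Cx Dy Cz xy yz.
by apply: (h x y z) => //; apply/e => //; exact: CD.
Qed.

(** The automorphisms fixing [B] preserve both orders and are transitive on [D], and the [lt']-ray
    at [a] is definable over [B] and [a]. Hence [fcu_two_orders] applies. *)
Lemma fcu_locus B D lt lt' : small_set K B -> locus B D ->
  dfn2 B lt -> dfn2 B lt' -> linear_order_on D lt -> linear_order_on D lt' ->
  (forall A X, dfn1 A X -> finite_convex_union D lt (X `&` D)) ->
  forall A X, dfn1 A X -> finite_convex_union D lt' (X `&` D).
Proof.
move=> sB lD d d' [o1 o2 o3] [o1' o2' o3'] w A X dX; apply/fcu_sig.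
have sigE (u v : {x | D x}) : sval u = sval v -> u = v.
  case: u v => [x Dx] [y Dy] /= e; subst y.
  by rewrite (Prop_irrelevance Dx Dy).
apply: (@fcu_two_orders _ (fun u v : {x | D x} => lt (sval u) (sval v))).
- split=> [[x Dx] _|[x Dx] [y Dy] [z Dz] _ _ _|[x Dx] [y Dy] _ _] /=; eauto.
  case: (o3 x y Dx Dy) => h; [constructor 1|constructor 2|constructor 3] => //.
  exact: sigE.
- split=> [[x Dx] _|[x Dx] [y Dy] [z Dz] _ _ _|[x Dx] [y Dy] _ _] /=; eauto.
  case: (o3' x y Dx Dy) => h; [constructor 1|constructor 2|constructor 3] => //.
  exact: sigE.
- move=> [a Da] [b Db]; have [s fs e] := locus_trans sB lD Da Db.
  have [[[s' sK s'K] _ _] _] := fs; have [hs sB'] := fs.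
  have Ds x : D x -> D (s x) by move=> Dx; apply/(locus_auto lD).
  exists (fun u => exist D (s (sval u)) (Ds _ (proj2_sig u))); split.
  + move=> [y Dy]; have Dy' : D (s' y) by apply/(locus_auto lD _ fs); rewrite s'K.
    by exists (exist D (s' y) Dy'); apply: sigE => /=.
  + by move=> x y /=; exact: dfn2_auto d hs sB'.
  + by move=> x y /=; exact: dfn2_auto d' hs sB'.
  + exact: sigE.
- move=> [a Da]; apply/fcu_sig => /=; apply: (w (B `|` [set a])).
  have Ba : (B `|` [set a]) a by right.
  have d2 : dfn2 (B `|` [set a]) lt' by apply: dfn_mono d' => x; left.
  by dfn.
- by apply/fcu_sig; exact: w dX.
Qed.

End Locus.

(** * Families of semiintervals without shifts *)

Section Powers.
Variables (T : Type) (lt : T -> T -> Prop) (S : T -> set T).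
Hypothesis O : linear_order_on [set: T] lt.

Definition semiintervals :=
  forall a, convex_in setT lt (S a) /\ is_min lt (S a) a.

Hypothesis Ss : semiintervals.

Lemma semi_refl a : S a a. Proof. by case: (Ss a) => _ []. Qed.

Lemma semi_ge a x : S a x -> ~ lt x a.
Proof. by case: (Ss a) => _ [_ h] /h [->|/(lo_asym O)//]; exact: (lo_irr O). Qed.

Lemma semi_down a x y : S a y -> ~ lt x a -> ~ lt y x -> S a x.
Proof.
move=> ay ax xy; have [cS _] := Ss a.
exact: (convex_between O cS (semi_refl a) I ay).
Qed.

Lemma spower_ge a n x : spower S a n x -> ~ lt x a.
Proof.
elim: n x => [|n IH] x /=; first exact: semi_ge.
by move=> [t /IH h /semi_ge h']; ord O.
Qed.

Lemma spower_sub a n : spower S a n `<=` spower S a n.+1.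
Proof. by move=> x h; exists x => //; exact: semi_refl. Qed.

Lemma spower_le a m n : (m <= n)%N -> spower S a m `<=` spower S a n.
Proof.
elim: n => [|n IH]; first by rewrite leqn0 => /eqP ->.
rewrite leq_eqVlt => /orP [/eqP -> //|]; rewrite ltnS => /IH h x /h.
exact: spower_sub.
Qed.

Lemma spower_down a n x y : spower S a n y -> ~ lt x a -> ~ lt y x -> spower S a n x.
Proof.
case: n => [|n]; first exact: semi_down.
elim: n x y => [|n IH] x y [t at_ ty] ax xy.
  have [xt|xt] := pselect (lt t x); last by exists a; [exact: semi_refl|apply: semi_down at_ _ _].
  by exists t => //; apply: semi_down ty _ _; ord O.
have [xt|xt] := pselect (lt t x); last by apply: spower_sub; apply: IH at_ _ _.
by exists t => //; apply: semi_down ty _ _; ord O.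
Qed.

Lemma not_shift a : ~ is_shift S a -> exists n, spower S a n.+1 `<=` spower S a n.
Proof.
move=> ns; apply: contrapT => no; apply: ns => n; split; first exact: spower_sub.
by move=> h; apply: no; exists n.
Qed.

End Powers.

(** * Definability and compactness for alternating chains *)

Section AltDefinable.
Variables (K : Type) (L : signature) (M : structure L).
Hypothesis small_language : small_set K [set: formula L nat].
Hypothesis Msat : saturated K M.
Variable lt : M -> M -> Prop.

Lemma alt_dfn A (P Q : M -> M -> Prop) n : dfn2 A lt -> dfn2 A P -> dfn2 A Q ->
  dfn2 A (fun a y => alt lt (P a) (Q a) n y).
Proof.
move=> dl dP dQ; elim: n P Q dP dQ => [|n IH] P Q dP dQ.
  apply: (dfn_iff (P := fun v => exists t, ~ lt (v 1%N) t /\ P (v 0%N) t)); last by dfn.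
  by move=> v; split=> -[t]; [move=> [h1 h2]|move=> [h1 h2 _]]; exists t.
pose R a y := alt lt (Q a) (P a) n y.
have dR : dfn2 A R by exact: IH.
apply: (dfn_iff (P := fun v => exists t, ~ lt (v 1%N) t /\ (P (v 0%N) t /\
   R (v 0%N) t))); last by dfn.
by move=> v; split=> -[t]; [move=> [h1 [h2 h3]]|move=> [h1 h2 h3]]; exists t.
Qed.

Lemma alt_dfn1 A (P Q : set M) n : dfn2 A lt -> dfn1 A P -> dfn1 A Q ->
  dfn1 A (alt lt P Q n).
Proof.
move=> dl dP dQ.
have d2 : dfn2 A (fun _ : M => alt lt P Q n).
  by apply: (alt_dfn (P := fun=> P) (Q := fun=> Q)) => //; rewrite /dfn2; dfn.
exact: (dfn2_at d2 (dterm_var A 0) (dterm_var A 0)).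
Qed.

Variables B D : set M.
Hypothesis lD : locus B D.
Hypothesis dlt : dfn2 B lt.

Hypothesis O : linear_order_on [set: M] lt.

(** The points are fixed one after another from the top, each in [D] and such that the chain
    continues below it inside every neighbourhood of [D]. *)
Lemma alt_compact C P Q n y : small_set K C -> B `<=` C -> dfn1 C P -> dfn1 C Q ->
  (forall X, nbd B D X -> alt lt (X `&` P) (X `&` Q) n y) ->
  alt lt (D `&` P) (D `&` Q) n y.
Proof.
move=> sC BC; elim: n P Q y => [|n IH] P Q y dP dQ h.
all: have sC' := small_setU1 small_language (a := y) sC.
all: have BC' : B `<=` C `|` [set y] by move=> x /BC; left.
all: have CC' : C `<=` C `|` [set y] by move=> x; left.
all: have Cy : (C `|` [set y]) y by right.
all: have dlt' := dfn_mono BC' dlt; have dP' := dfn_mono CC' dP; have dQ' := dfn_mono CC' dQ.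
  have [|||t Dt ht] := locus_compact Msat lD (Y := fun X => [set t | ~ lt y t /\ P t]) sC' BC'.
  - by move=> X [dX _]; rewrite /dfn1 /=; dfn.
  - by move=> X X' _ t.
  - by move=> X /h [t [h1 [h2 h3] _]]; exists t.
  by have [h1 h2] := ht _ (nbdT B D); exists t.
have [|||t Dt ht] := locus_compact Msat lD
  (Y := fun X => [set t | ~ lt y t /\ P t /\ alt lt (X `&` Q) (X `&` P) n t]) sC' BC'.
- move=> X [dX _]; have dX' := dfn_mono BC' dX.
  have dalt : dfn1 (C `|` [set y]) (alt lt (X `&` Q) (X `&` P) n).
    by apply: alt_dfn1 => //; apply: dfn_and.
  by rewrite /dfn1 /=; dfn.
- move=> X X' XX' t [h1 [h2 h3]]; do !split=> //.
  by apply: (alt_sub O) h3 => x _ [? ?]; split=> //; exact: XX'.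
- by move=> X /h [t [h1 [h2 h3] h4]]; exists t.
exists t; split; first by have [] := ht _ (nbdT B D).
  by have [_ []] := ht _ (nbdT B D).
by apply: IH => // X /ht [_ []].
Qed.

End AltDefinable.

(** * Coherence in the absence of shifts *)

Section NoShift.
Variables (K : Type) (L : signature) (M : structure L).
Hypothesis small_language : small_set K [set: formula L nat].
Hypothesis Msat : saturated K M.
Hypothesis Mhom : strongly_homogeneous K M.
Variable lt : M -> M -> Prop.
Hypothesis O : linear_order_on [set: M] lt.
Variables B D : set M.
Hypothesis sB : small_set K B.
Hypothesis lD : locus B D.
Hypothesis dlt : dfn2 B lt.

Lemma spower_auto S s a x n : dfn2 B S -> fixes B s ->
  (spower S (s a) n (s x) <-> spower S a n x).
Proof.
move=> dS [hs sB']; have dS2 y z : S (s y) (s z) <-> S y z.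
  exact: dfn2_auto dS hs sB'.
have [[s' sK s'K] _ _] := hs.
elim: n x => [|n IH] x //=; split=> -[t h1 h2].
  by exists (s' t); [apply/IH|apply/dS2]; rewrite s'K.
by exists (s t); [apply/IH|apply/dS2].
Qed.

Hypothesis noshift : forall S : M -> set M,
  semiintervals lt S -> dfn2 B S -> forall a, ~ is_shift S a.

(** By transitivity the powers stabilize at the same index [N] all over [D]. Let [m] be the least
    index whose power contains the [N]-th one within [D]. Monotonicity forces [m] to be [0], so that
    within [D] the set [S a] is already closed under further steps. *)
Lemma monotone_coherent S : semiintervals lt S -> dfn2 B S ->
  (forall x t y, S x y -> ~ lt t x -> ~ lt y t -> S t y) -> coherent lt D S.
Proof.
move=> Ss dS mono a b y Da Db Dy ab yb.
have [N hN] := not_shift Ss (noshift Ss dS (a := a)).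
have auto := fun s a x n => @spower_auto S s a x n dS.
have stab c : D c -> spower S c N.+1 `<=` spower S c N.
  move=> Dc; have [s fs <-] := locus_trans small_language Mhom sB lD Da Dc.
  have [[[s' sK s'K] _ _] _] := fs.
  move=> x; rewrite -(s'K x) => /(auto _ _ _ _ fs) /hN h.
  exact/(auto _ _ _ _ fs).
pose full m := forall c x, D c -> D x -> spower S c N x -> spower S c m x.
have [m fm mmin] : exists2 m, full m & forall m', full m' -> (m <= m')%N.
  have exf : exists m, `[< full m >] by exists N; apply/asboolP.
  exists (ex_minn exf); case: ex_minnP => m /asboolP // fm hm.
  by move=> m' fm'; apply: hm; apply/asboolP.
case: m fm mmin => [|m] fm mmin.
  split=> [ay|by_].
    exact: mono ay (semi_ge O Ss ab) yb.
  apply: (fm) => //; apply: stab => //; exists b => //.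
  exact: (@spower_le _ _ _ Ss a 0 N (leq0n N) _ ab).
exfalso.
have notfull m' c : D c -> (m' <= m)%N -> exists u, [/\ D u, spower S c N u & ~ spower S c m' u].
  move=> Dc m'm; apply: contrapT => no.
  suff /mmin : full m' by rewrite ltnNge m'm.
  move=> c' x Dc' Dx h; apply: contrapT => nh; apply: no.
  have [s fs <-] := locus_trans small_language Mhom sB lD Dc' Dc.
  exists (s x); split; [exact/(locus_auto lD)|exact/auto|].
  by move/(auto _ _ _ _ fs).
(* [u] is outside the [m]-th power at [a], and [z] is outside [S u]. But [z] lies in [S t] for some
   [t] in that power; such a [t] is below [u], and [mono] puts [z] into [S u]. *)
have [u [Du au nau]] := notfull m a Da (leqnn m).
have [z [Dz uz nuz]] := notfull 0%N u Du (leq0n m).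
have az : spower S a N z.
  suff H k x : spower S u k x -> spower S a N x by exact: H uz.
  elim: k x => [|k IH] x /= h.
    by apply: stab => //; exists u.
  by case: h => t /IH h1 h2; apply: stab => //; exists t.
have [t at_ tz] := fm _ _ Da Dz az.
have zu := spower_ge O Ss uz; have ua := spower_ge O Ss au.
apply: nuz; apply: mono tz _ zu => ut; apply: nau.
by apply: (spower_down O Ss at_ ua); ord O.
Qed.

(** [S] made nondecreasing by admitting all starting points of [X] up to [a]. The clause [y = a]
    ensures that the result is a semiinterval at every [a], also outside [X]. *)
Let upper (S : M -> set M) (X : set M) (a y : M) :=
  y = a \/ (~ lt y a /\ exists t, [/\ X t, ~ lt a t & S t y]).

Let B2 a y := (B `|` [set a]) `|` [set y].

Let sB2 a y : small_set K (B2 a y).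
Proof. exact: (small_setU1 small_language (small_setU1 small_language sB)). Qed.

Let BB2 a y : B `<=` B2 a y.
Proof. by move=> x; left; left. Qed.

Let coherent_upper S X : semiintervals lt S -> dfn2 B S -> nbd B D X ->
  coherent lt D (upper S X).
Proof.
move=> Ss dS [dX DX]; apply: monotone_coherent.
- move=> a; split; [split=> // x y z|split].
  + move=> h1 _ h3 xy yz; right.
    have xa : ~ lt x a by case: h1 => [->|[]//]; exact: (lo_irr O).
    split; first by ord O.
    case: h3 => [e|[za [t [Xt at_ tz]]]]; first by exfalso; ord O.
    by exists t; split=> //; apply: (semi_down O Ss tz); ord O.
  + by left.
  + by move=> x [->|[/(lo_nlt O) [->|]]]; [left|left|right].
- rewrite /upper; apply: dfn_or; first by dfn.
  apply: (dfn_iff (P := fun v => ~ lt (v 1%N) (v 0%N) /\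
      exists t, X t /\ ~ lt (v 0%N) t /\ S t (v 1%N))).
    by move=> v; split=> -[h [t ht]]; split=> //; exists t; case: ht => // ? [].
  by dfn.
- move=> x t y [->|[h1 [u [Xu xu uy]]]] xt ty; first by left; ord O.
  by right; split=> //; exists u; split=> //; ord O.
Qed.

Hypothesis fcuD : forall A X, dfn1 A X -> finite_convex_union D lt (X `&` D).

(* [upperD], the limit of [upper S X] along the [B]-definable neighbourhoods [X]
   of [D], is coherent and contains [S]. If it is not contained in [S] everywhere
   between two points, then [[set t | S t y]] and its complement are both coinitial
   in an [upperD]-class, against weak o-minimality. *)
Lemma noshift_coherent S : semiintervals lt S -> dfn2 B S -> coherent lt D S.
Proof.
move=> Ss dS.
pose upperD a y := exists t, [/\ D t, ~ lt a t & S t y].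
have upperP a y : D a -> D y -> ~ lt y a ->
    (upperD a y <-> forall X, nbd B D X -> upper S X a y).
  move=> Da Dy ya; split=> [[t [Dt at_ ty]] X [_ DX]|h].
    by right; split=> //; exists t; split=> //; exact: DX.
  have [ya'|ne] := pselect (y = a).
    by exists a; split=> //; [exact: (lo_irr O)|rewrite ya'; exact: (semi_refl Ss)].
  pose Y X := [set t | X t /\ (~ lt a t /\ S t y)].
  have [|||t Dt ht] := locus_compact Msat lD (Y := Y) (@sB2 a y) (@BB2 a y).
  - move=> X [dX _].
    have Ca : B2 a y a by left; right.
    have Cy : B2 a y y by right.
    have dX' := dfn_mono (@BB2 a y) dX; have dS' := dfn_mono (@BB2 a y) dS.
    have dlt' := dfn_mono (@BB2 a y) dlt.
    by rewrite /dfn1 /Y /=; dfn.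
  - by move=> X X' XX' t [h1 h2]; split=> //; exact: XX'.
  - by move=> X nX; case: (h X nX) => [//|[_ [t [Xt at_ ty]]]]; exists t.
  - by have [_ []] := ht _ (nbdT B D); exists t.
have coh_upper : forall a b y, D a -> D b -> D y -> ~ lt b a -> ~ lt y b ->
    upperD a b -> (upperD a y <-> upperD b y).
  move=> a b y Da Db Dy ba yb /upperP h.
  rewrite !upperP //; last by ord O.
  split=> h' X nX; first by apply/(coherent_upper Ss dS nX Da Db Dy) => //; [exact: h|exact: h'].
  by apply/(coherent_upper Ss dS nX Da Db Dy (h Da Db ba X nX)) => //; exact: h'.
have up_down a x y : upperD a y -> ~ lt x a -> ~ lt y x -> upperD a x.
  move=> [t [Dt at_ ty]] xa yx; exists t; split=> //.
  by apply: (semi_down O Ss ty); ord O.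
have [all|] := pselect (forall a y t, D a -> D y -> D t ->
    upperD a y -> ~ lt t a -> ~ lt y t -> S t y).
  have irr := lo_irr O.
  have SU a y : D a -> S a y -> upperD a y by move=> Da ay; exists a; split.
  move=> a b y Da Db Dy ab yb; have ba := semi_ge O Ss ab.
  have ub := coh_upper a b y Da Db Dy ba yb (SU a b Da ab).
  split=> h.
    by apply: (all b y b) => //; apply/ub; exact: SU.
  by apply: (all a y a) => //; [apply/ub; exact: SU|ord O].
move=> /existsNP [a1 /existsNP [y1 /existsNP [t1 no]]]; exfalso.
have [Da1 [Dy1 [Dt1 [u1 [ta1 [yt1 nS1]]]]]] : D a1 /\ D y1 /\ D t1 /\
    upperD a1 y1 /\ ~ lt t1 a1 /\ ~ lt y1 t1 /\ ~ S t1 y1.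
  by do ![move/not_implyP: no => [? no]; split=> //].
have dX : dfn1 (B `|` [set y1]) (fun t => S t y1).
  have Cy : (B `|` [set y1]) y1 by right.
  have dS' : dfn2 (B `|` [set y1]) S by apply: dfn_mono dS => x; left.
  by rewrite /dfn1 /=; dfn.
have [n hn] := fcu_alt (lo_rev O) (fcu_rev (fcuD dX)).
(* By weak o-minimality the points [t] with and without [S t y1] cannot alternate downwards for ever
   among those with [upperD t y1], and the former are coinitial there. *)
have [b0 [Db0 yb0 u0 h0]] : exists b0, [/\ D b0, ~ lt y1 b0, upperD b0 y1 &
    forall b, D b -> ~ lt b0 b -> upperD b y1 -> S b y1].
  apply: contrapT => nob.
  pose P := [set t | [/\ D t, ~ lt y1 t & S t y1]].
  pose Q := [set t | [/\ D t, ~ lt y1 t, upperD t y1 & ~ S t y1]].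
  have [t0 [Dt0 at0 ty0]] := u1.
  have Pt0 : P t0 by split=> //; ord O.
  have PU t : P t -> upperD t y1 by move=> [Dt _ ty]; exists t; split=> //; exact: (lo_irr O).
  have [z hz] : exists z, alt (fun x y => lt y x) P Q n z.
    apply: (alt_unbounded (lo_rev O) Pt0) => [x Px|x [Dx yx [t [Dt xt ty]] _]].
      apply: contrapT => noq; apply: nob; exists x; split; [by case: Px|by case: Px|exact: PU|].
      move=> b Db xb ub; apply: contrapT => nS; apply: noq; exists b => //.
      by split=> //; case: Px => ? ? ?; ord O.
    by exists t => //; split=> //; ord O.
  have [] := hn P Q n z _ _ (leqnn n); last by move/(_ hz).
  - by move=> x [].
  - by move=> x [Dx _ _ nS]; split=> // -[].
(* Moving [y1] to [b0] brings the counterexample into the region below [b0], where [upperD] implies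
   [S]. *)
have [s fs sy] := locus_trans small_language Mhom sB lD Dy1 Db0.
have [hs sB'] := fs.
have Dsa : D (s a1) by apply/(locus_auto lD).
have Dst : D (s t1) by apply/(locus_auto lD).
have S2 x y : S (s x) (s y) <-> S x y by exact: dfn2_auto dS hs sB'.
have L2 x y : lt (s x) (s y) <-> lt x y by exact: dfn2_auto dlt hs sB'.
have usa : upperD (s a1) b0.
  case: u1 => t [Dt at_ ty]; exists (s t); rewrite -sy; split; last exact/S2.
    exact/(locus_auto lD).
  by move/L2.
have tb0 : ~ lt b0 (s t1) by rewrite -sy => /L2.
have tsa : ~ lt (s t1) (s a1) by move/L2.
apply: nS1; apply/S2; rewrite sy.
have b0a : ~ lt b0 (s a1) by ord O.
have ust : upperD (s t1) y1.
  apply/(coh_upper (s a1) (s t1) y1) => //; first by ord O.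
    exact: up_down usa _ _.
  by apply/(coh_upper (s a1) b0 y1).
by apply: (semi_down O Ss (h0 _ Dst _ ust)).
Qed.

Let altin (phi psi : M -> M -> Prop) (X : set M) (n : nat) (a : M) : set M :=
  alt lt (X `&` [set t | lt a t /\ phi a t]) (X `&` [set t | lt a t /\ psi a t]) n.

Let altin_dfn phi psi X n : dfn2 B phi -> dfn2 B psi -> dfn1 B X ->
  dfn2 B (altin phi psi X n).
Proof.
move=> dphi dpsi dX; rewrite /altin.
apply: (alt_dfn (P := fun a t => X t /\ (lt a t /\ phi a t))
  (Q := fun a t => X t /\ (lt a t /\ psi a t))) => //; rewrite /dfn2; dfn.
Qed.

Let altin_compact phi psi n a y : dfn2 B phi -> dfn2 B psi ->
  (forall X, nbd B D X -> altin phi psi X n a y) -> altin phi psi D n a y.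
Proof.
move=> dphi dpsi; have Ca : (B `|` [set a]) a by right.
have BC : B `<=` B `|` [set a] by move=> t; left.
have dp' := dfn_mono BC dphi; have dq' := dfn_mono BC dpsi.
have dlt' := dfn_mono BC dlt.
apply: (alt_compact small_language Msat lD dlt O (small_setU1 small_language sB) BC);
  rewrite /dfn1 /=; dfn.
Qed.

(** Invariance is required in place of definability: the relation found in [separating_eqv] comes
    from a union over all neighbourhoods of [D]. *)
Definition convex_eqv (H : M -> M -> Prop) :=
  [/\ forall x, D x -> H x x,
      forall x y, D x -> D y -> H x y -> H y x,
      forall x y z, D x -> D y -> D z -> H x y -> H y z -> H x z,
      forall x y z, D x -> D y -> D z -> H x z -> ~ lt y x -> ~ lt z y -> H x y &
      forall s x y, fixes B s -> D x -> D y -> H x y -> H (s x) (s y)].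

Lemma coherent_convex_eqv (S : M -> set M) :
  (forall a, S a a) -> (forall a y, S a y -> ~ lt y a) ->
  (forall a x y, D a -> D x -> D y -> S a y -> ~ lt x a -> ~ lt y x -> S a x) ->
  (forall s x y, fixes B s -> S x y -> S (s x) (s y)) ->
  coherent lt D S -> convex_eqv (fun x y => S x y \/ S y x).
Proof.
move=> Sr Sge Sc Si coh; split.
- by left.
- by move=> x y _ _ [|]; [right|left].
- move=> x y z Dx Dy Dz; apply: (coherent_trans O (D := D)) => //.
  by move=> a u _ _; exact: Sge.
- move=> x y z Dx Dy Dz; apply: (coherent_between O (D := D)) => //.
  by move=> a u _ _; exact: Sge.
- by move=> s x y fs _ _ [h|h]; [left|right]; exact: Si.
Qed.

(** Let [i] be the least index for which no chain in [D] alternating between [phi a] and [psi a],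
    with top in [phi a], occurs up to [x]. Such a chain does occur up to [y]. The points above [u]
    before which no chain of index [i] for [u] appears form a coherent family, whose relation
    separates [x] from [y]. *)
Lemma separating_eqv phi psi a x y :
  dfn2 B phi -> dfn2 B psi -> (forall t, D t -> psi a t <-> ~ phi a t) ->
  D a -> D x -> D y -> lt a x -> lt x y -> psi a x -> phi a y ->
  exists2 H, convex_eqv H & H a x /\ ~ H a y.
Proof.
move=> dphi dpsi hpsi Da Dx Dy ax xy px py.
pose fam X i a z := z = a \/ (lt a z /\ ~ altin phi psi X i a z).
have ex_i : exists i, `[< ~ altin phi psi D i a x >].
  have dX : dfn1 (B `|` [set a]) (phi a).
    have Ca : (B `|` [set a]) a by right.
    have dphi' : dfn2 (B `|` [set a]) phi by apply: dfn_mono dphi => t; left.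
    by rewrite /dfn1 /=; dfn.
  have [n hn] := fcu_alt O (fcuD dX); exists n; apply/asboolP.
  apply: (hn _ _ n x _ _ (leqnn n)).1; first by move=> t [? []].
  by move=> t [Dt [_ /(hpsi _ Dt) h]]; split=> // -[].
have [i ni mini] : exists2 i, ~ altin phi psi D i a x &
    forall j, (j < i)%N -> altin phi psi D j a x.
  exists (ex_minn ex_i); case: ex_minnP => i /asboolP // ni hi.
  by move=> j ji; apply: contrapT => nj; move: ji; rewrite ltnNge hi //; exact/asboolP.
(* For [i] at least two, minimality gives a chain of index [i - 2] up to [x]; the points [x] and [y]
   are then put on top of it. *)
have yi : altin phi psi D i a y.
  have ay : lt a y by ord O.
  have irr := lo_irr O.
  case: i ni mini => [|i] ni mini.
    by apply: alt0 => //.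
  apply: (altS O (x := x)); [by []|by ord O|].
  case: i ni mini => [|i] ni mini; first exact: alt0.
  apply: (altS O (x := x)); [by []|by []|].
  exact: mini.
pose S z : set M := fam D i z.
have famP X : nbd B D X -> coherent lt D (fam X i).
  move=> [dX DX]; apply: noshift_coherent.
  - move=> b; split; [split=> // u v w hu _ hw uv vw|split].
    + have bv : lt b v by case: hu => [e|[bu _]]; ord O.
      case: hw => [e|[bw nw]]; first by subst w; exfalso; ord O.
      right; split=> // h; apply: nw; apply: (alt_ge O) h; ord O.
    + by left.
    + by move=> u [->|[]]; [left|right].
  - have da := altin_dfn i dphi dpsi dX.
    by rewrite /fam; dfn.
(* By compactness [S] is the union of the families [fam X i], which are definable and hence
   coherent. *)
have SP u v : S u v <-> exists2 X, nbd B D X & fam X i u v.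
  split=> [[->|[uv nalt]]|[X [_ DX] [->|[uv nalt]]]].
  - by exists setT; [exact: nbdT|left].
  - apply: contrapT => no; apply: nalt; apply: altin_compact => // X nX.
    by apply: contrapT => nalt; apply: no; exists X => //; right.
  - by left.
  - right; split=> // h; apply: nalt; apply: (alt_sub O) h => t _ [h1 h2]; split=> //; exact: DX.
have mon X X' u v : X `<=` X' -> fam X' i u v -> fam X i u v.
  move=> XX' [->|[uv h]]; [by left|right; split=> // h'; apply: h].
  by apply: (alt_sub O) h' => t _ [? ?]; split=> //; exact: XX'.
have irr := lo_irr O.
have Sge u v : S u v -> ~ lt v u by move=> [->|[h _]]; [exact: irr|exact: lo_asym].
exists (fun u v => S u v \/ S v u).
  apply: coherent_convex_eqv => //.
  - by move=> u; left.
  - move=> u v w Du Dv Dw [->|[uw nw]] uv wv; first by left; ord O.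
    have [vu|vu] := pselect (v = u); first by left.
    right; split; first by case: (lo_nlt O uv) => // e; case: vu.
    by move=> h; apply: nw; apply: (alt_ge O) h.
  - move=> s u v fs; have [hs sB'] := fs; have [[s' sK s'K] _ _] := hs.
    have L2 p q : lt (s p) (s q) <-> lt p q by exact: dfn2_auto dlt hs sB'.
    move=> [->|[uv h]]; [by left|right; split; first exact/L2].
    have I2 R p q : dfn2 B R -> (R (s p) (s q) -> R p q).
      by move=> dR; apply: (dfn2_auto _ _ dR hs sB').1.
    have I1 p : D (s p) -> D p by move/(locus_auto lD _ fs).
    move=> h'; apply: h.
    have : alt lt (D `&` [set t | lt u t /\ phi u t])
       (D `&` [set t | lt u t /\ psi u t]) i (s' (s v)).
      apply: alt_transport h' => [p q|p [h1 [h2 h3]]|p [h1 [h2 h3]]] /=.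
      + by rewrite -L2 !s'K.
      + by split; [apply: I1|split; [apply/L2|apply: I2 dphi _]]; rewrite s'K.
      + by split; [apply: I1|split; [apply/L2|apply: I2 dpsi _]]; rewrite s'K.
    by rewrite sK.
  - move=> p q r Dp Dq Dr /SP [X nX pq] rq; split=> /SP [X' nX' h].
      have nI := nbdI nX nX'; apply/SP; exists (X `&` X') => //.
      apply/(famP _ nI p q r) => //; first by apply: mon pq => t [].
      by apply: mon h => t [].
    have nI := nbdI nX nX'; apply/SP; exists (X `&` X') => //.
    apply/(famP _ nI p q r) => //; first by apply: mon pq => t [].
    by apply: mon h => t [].
split; first by left; right.
move=> [[e|[_ h]]|/Sge h]; [by subst y; ord O|exact: h|by apply: h; ord O].
Qed.

End NoShift.

(** * Without shifts, semiintervals are simple *)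

Lemma dfn_param (L : signature) (M : structure L) (B : set M) a (X : set M) :
  dfn1 (B `|` [set a]) X ->
  exists2 R : M -> M -> Prop, dfn2 B R & forall x, X x <-> R a x.
Proof.
move=> [phi h].
have /choice [g hg] : forall c : {c | (B `|` [set a]) c},
    exists w : nat + {c | B c}, forall v : nat -> M, v 0%N = a -> valA v w = sval c.
  move=> [c Bc]; have [Bc'|nB] := pselect (B c).
    by exists (inr (exist B c Bc')).
  by exists (inl 0%N) => v /= ->; case: Bc => [//|->].
pose f (w : nat + {c | (B `|` [set a]) c}) :=
  match w with inl _ => inl 1%N | inr c => g c end.
exists (fun x y => sat (valA (A := B) (fun n => if n is 0 then x else y)) (rename f phi)).
  exists (rename (fun w => match w with inl 0 => inl 0%N | inl _ => inl 1%N | inr c => inr c end) (rename f phi)).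
  move=> v; rewrite [X in _ <-> X]sat_rename.
  match goal with |- sat ?f _ <-> sat ?g _ => suff -> : f = g by [] end.
  by apply/funext => -[[|n]|c].
move=> x; rewrite (h (fun=> x)) sat_rename.
match goal with |- sat ?f phi <-> sat ?g phi => suff -> : f = g by [] end.
by apply/funext => -[n|c] //=; rewrite hg.
Qed.

Section Simple.
Variables (K : Type) (L : signature) (M : structure L).
Hypothesis small_language : small_set K [set: formula L nat].
Hypothesis Msat : saturated K M.
Hypothesis Mhom : strongly_homogeneous K M.
Variable lt : M -> M -> Prop.
Hypothesis O : linear_order_on [set: M] lt.
Variables B D : set M.
Hypothesis sB : small_set K B.
Hypothesis lD : locus B D.
Hypothesis dlt : dfn2 B lt.
Hypothesis noshift : forall S : M -> set M,
  semiintervals lt S -> dfn2 B S -> forall a, ~ is_shift S a.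
Hypothesis fcuD : forall A X, dfn1 A X -> finite_convex_union D lt (X `&` D).

Let eqv := convex_eqv lt B D.

Let auto2 R s x y : dfn2 B R -> fixes B s -> (R (s x) (s y) <-> R x y).
Proof. by move=> dR [hs sB']; exact: dfn2_auto dR hs sB'. Qed.

Let trans a b : D a -> D b -> exists2 s, fixes B s & s a = b.
Proof. exact: (locus_trans small_language Mhom sB lD). Qed.

Let eqv_inv H s x y : eqv H -> fixes B s -> D x -> D y -> (H (s x) (s y) <-> H x y).
Proof.
move=> [_ _ _ _ hH] fs Dx Dy; split; last exact: hH.
have [s' [fs' sK s'K]] := fixes_inv fs.
by move=> /(hH _ _ _ fs'); rewrite !sK; apply; apply/(locus_auto lD).
Qed.

(** After an automorphism the pairs [x, y] and [u, v] have the same lower point. By convexity the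
    nearer of the two upper points is then related to it by both relations. *)
Lemma convex_eqv_chain H H' x y u v : eqv H -> eqv H' ->
  D x -> D y -> D u -> D v -> H x y -> ~ H' x y -> H' u v -> H u v.
Proof.
move=> eH eH' Dx Dy Du Dv xy nxy uv; apply: contrapT => nuv.
have irr := lo_irr O.
wlog lxy : x y Dx Dy xy nxy / lt x y => [W|].
  case: (lo_tot O x y) => [|e|yx]; first exact: W.
    by subst y; apply: nxy; case: eH' => r _ _ _ _; exact: r.
  apply: (W y x) => //; first by case: eH => _ s _ _ _; exact: s.
  by case: eH' => _ s _ _ _ /s; auto.
wlog luv : u v Du Dv uv nuv / lt u v => [W|].
  case: (lo_tot O u v) => [|e|vu]; first exact: W.
    by subst v; apply: nuv; case: eH => r _ _ _ _; exact: r.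
  apply: (W v u) => //; first by case: eH' => _ s _ _ _; exact: s.
  by case: eH => _ s _ _ _ /s; auto.
have [s fs sx] := trans Du Dx.
have Dsv : D (s v) by apply/(locus_auto lD).
have xsv : H' x (s v) by rewrite -sx (eqv_inv eH' fs).
have nxsv : ~ H x (s v) by rewrite -sx (eqv_inv eH fs).
have lsv : lt x (s v) by rewrite -sx (auto2 _ _ dlt fs).
have [yv|vy] := pselect (lt (s v) y).
  by apply: nxsv; case: eH => _ _ _ c _; apply: (c x (s v) y) => //; ord O.
by apply: nxy; case: eH' => _ _ _ c _; apply: (c x y (s v)) => //; ord O.
Qed.

Let separate phi a x y : dfn2 B phi -> D a -> D x -> D y -> lt a x -> lt x y ->
  ~ (phi a x <-> phi a y) -> exists2 H, eqv H & H a x /\ ~ H a y.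
Proof.
move=> dphi Da Dx Dy ax xy n.
have dpsi : dfn2 B (fun u v => ~ phi u v) by rewrite /dfn2; dfn.
have [px|px] := pselect (phi a x).
  apply: (separating_eqv small_language Msat Mhom O sB lD dlt noshift fcuD
    dpsi dphi _ Da Dx Dy ax xy px) => [t _|py].
    by split; [tauto|exact: contrapT].
  by apply: n; split.
have py : phi a y by apply: contrapT => py; apply: n; tauto.
exact: (separating_eqv small_language Msat Mhom O sB lD dlt noshift fcuD
  dphi dpsi _ Da Dx Dy ax xy px py).
Qed.

(** Symmetry of [E] allows both pairs to be listed in increasing order. Moving [x'] to [x] then
    gives two points above [x] at which [E x] takes different truth values. *)
Lemma sym_separated E x y x' y' : dfn2 B E ->
  (forall u v, D u -> D v -> E u v -> E v u) ->
  D x -> D y -> D x' -> D y' -> x <> y -> x' <> y' -> E x y -> ~ E x' y' ->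
  exists2 H, eqv H & (H x y /\ ~ H x' y') \/ (~ H x y /\ H x' y').
Proof.
move=> dE sE Dx Dy Dx' Dy' ne ne' xy nxy.
wlog lxy : x y Dx Dy ne xy / lt x y => [W|].
  case: (lo_tot O x y) => [|//|yx]; first exact: W.
  have [|H eH h] := W y x Dy Dx _ (sE _ _ Dx Dy xy) yx; first by move=> e; apply: ne.
  exists H => //; have sH u v : D u -> D v -> H u v <-> H v u.
    by case: eH => _ s _ _ _; split; exact: s.
  by rewrite (sH x y).
wlog lxy' : x' y' Dx' Dy' ne' nxy / lt x' y' => [W|].
  case: (lo_tot O x' y') => [|//|yx]; first exact: W.
  have [||H eH h] := W y' x' Dy' Dx' _ _ yx.
  - by move=> e; apply: ne'.
  - by move=> /sE; auto.
  exists H => //; have sH u v : D u -> D v -> H u v <-> H v u.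
    by case: eH => _ s _ _ _; split; exact: s.
  by rewrite (sH x' y').
have [s fs sx] := trans Dx' Dx.
have Dsy : D (s y') by apply/(locus_auto lD).
have nE : ~ E x (s y') by rewrite -sx (auto2 _ _ dE fs).
have lsy : lt x (s y') by rewrite -sx (auto2 _ _ dlt fs).
have hI H : eqv H -> (H x (s y') <-> H x' y') by move=> eH; rewrite -sx; exact: (eqv_inv eH fs).
case: (lo_tot O y (s y')) => [h|e|h]; last 2 first.
- by case: nE; rewrite -e.
- have [|H eH [h1 h2]] := separate dE Dx Dsy Dy lsy h; first by tauto.
  by exists H => //; right; split=> //; apply/hI.
have [|H eH [h1 h2]] := separate dE Dx Dy Dsy lxy h; first by tauto.
by exists H => //; left; split=> // /(hI _ eH).
Qed.

(** In effect, the classes of [H] are convex for [q] too. If [y] is below [a] and [t], a relation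
    separating [a] from [t] as seen from [y] would be contained in [H] and would relate [y] to [a].
    If [y] is above them, moving [t] to [a] takes [y] to a point [s y] that no invariant convex
    relation distinguishes from [y] as seen from [a]. *)
Lemma order_separated q H a t y : dfn2 B q -> linear_order_on D q -> eqv H ->
  D a -> D t -> D y -> H a t -> ~ H a y -> (q a y <-> q t y).
Proof.
move=> dq [q1 q2 q3] eH Da Dt Dy at_ nay.
case: (eH) => rH sH tH cH _.
have nty : ~ H t y by move=> h; apply: nay; exact: tH at_ h.
wlog lat : a t Da Dt at_ nay nty / lt a t => [W|].
  case: (lo_tot O a t) => [h|->//|h]; first exact: W.
  by have -> := W t a Dt Da (sH _ _ Da Dt at_) nty nay h.
have irr := lo_irr O.
case: (lo_tot O y a) => [ya|e|ay].
- have flip u : D u -> ~ H u y -> (q u y <-> ~ q y u).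
    move=> Du nu; split=> [h h'|h]; first exact: (q1 u Du (q2 _ _ _ Du Dy Du h h')).
    case: (q3 u y Du Dy) => // e; by subst u; case: nu; exact: rH.
  rewrite !flip //; apply: contrapT => n.
  have [|H' eH' [h1 h2]] := separate dq Dy Da Dt ya lat; first by tauto.
  case: (eH') => _ sH' tH' _ _.
  apply: nay; apply: sH => //; apply: (convex_eqv_chain eH eH' Da Dt) => //.
  by move=> h; apply: h2; apply: tH' h.
- by subst y; case: nay; exact: rH.
have [ty|ty] := pselect (lt t y); last by case: nay; apply: (cH a y t) => //; ord O.
have [s fs st] := trans Dt Da.
have Dsy : D (s y) by apply/(locus_auto lD).
have qs : q a (s y) <-> q t y by rewrite -st; exact: (auto2 _ _ dq fs).
have ls : lt a (s y) by rewrite -st (auto2 _ _ dlt fs).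
rewrite -qs; apply: contrapT => n.
have key H' : eqv H' -> H' a (s y) -> H' a y.
  move=> eH'; rewrite -{1}st (eqv_inv eH' fs) // => h.
  case: (eH') => _ sH' tH' cH' _.
  suff : H' a t by move=> h'; exact: tH' h.
  by apply: (convex_eqv_chain eH' eH Dt Dy).
have key2 H' : eqv H' -> H' a y -> H' a (s y).
  move=> eH' h; rewrite -{1}st (eqv_inv eH' fs) //.
  case: (eH') => _ sH' tH' cH' _.
  have h' : H' a t by apply: (cH' a t y) => //; ord O.
  exact: tH' (sH' _ _ Da Dt h') h.
case: (lo_tot O y (s y)) => [h|e|h].
- have [|H' eH' [h1 h2]] := separate dq Da Dy Dsy ay h; first by tauto.
  by apply: h2; exact: key2.
- by apply: n; rewrite -e.
- have [|H' eH' [h1 h2]] := separate dq Da Dsy Dy ls h; first by tauto.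
  by apply: h2; exact: key.
Qed.

(** If transitivity fails at [x, y, z], some [H] distinguishes the pair [x, y] from [x, z], and some
    [H'] distinguishes [y, z] from [x, z]. By [C1] neither of them relates [x] to [z]. So [H]
    relates [x, y] and [H'] relates [y, z]; as the two are comparable, the coarser one relates [x]
    to [z] after all. *)
Lemma simple_of_noshift q R : dfn2 B q -> linear_order_on D q -> dfn2 B R ->
  (forall a, D a -> convex_in D q (R a `&` D) /\ is_min q (R a `&` D) a) ->
  forall x y z, D x -> D y -> D z ->
    R x y \/ R y x -> R y z \/ R z y -> R x z \/ R z x.
Proof.
move=> dq oq dR hR; case: (oq) => q1 q2 q3.
pose E x y := R x y \/ R y x.
have dE : dfn2 B E by rewrite /dfn2 /E; dfn.
have sE u v : D u -> D v -> E u v -> E v u by move=> _ _ []; [right|left].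
have qasym u v : D u -> D v -> q u v -> ~ q v u.
  by move=> Du Dv h h'; apply: (q1 u Du); exact: q2 h h'.
have Rq x y : D x -> D y -> R x y -> ~ q y x.
  by move=> Dx Dy xy; have [_ [_ /(_ y (conj xy Dy)) [->|/qasym]]] := hR x Dx; auto.
have ER x y : D x -> D y -> E x y -> q x y -> R x y.
  by move=> Dx Dy [//|/Rq h] /h; case.
have Rconv x y z : D x -> D y -> D z -> R x z -> q x y -> q y z -> R x y.
  move=> Dx Dy Dz xz xy yz; have [[_ cR] [Rx _]] := hR x Dx.
  by have [] := cR x y z Rx Dy (conj xz Dz) xy yz.
have Rr x : D x -> R x x by move=> Dx; have [_ [[]]] := hR x Dx.
have sep := fun H a t y => @order_separated q H a t y dq oq.
(* By [order_separated], [x] and [z] are on the same [q]-side of [y]. If [y] is above, convexity of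
   [R x] gives [R x z]. If [y] is below, moving [x] to [y] sends [z] into the [q]-interval from [y]
   to [x], which is contained in [R y]. *)
have C1 H x y z : eqv H -> D x -> D y -> D z -> E x y -> E y z -> ~ E x z ->
    H x z -> ~ H x y -> False.
  move=> eH Dx Dy Dz xy yz nxz hxz nxy.
  case: (eH) => _ sH tH _ _.
  wlog qxz : x z Dx Dz xy yz nxz hxz nxy / q x z => [W|].
    case: (q3 x z Dx Dz) => [|e|h]; first exact: W.
      by apply: nxz; subst z; left; exact: Rr.
    apply: (W z x) => //; try exact: sE; try exact: sH.
    - by move/sE; auto.
    - by move=> h'; apply: nxy; exact: tH hxz h'.
  have qE : q x y <-> q z y by exact: sep eH Dx Dz Dy hxz nxy.
  case: (q3 x y Dx Dy) => [qxy|e|qyx].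
  - apply: nxz; left; apply: (Rconv x z y) => //; last exact/qE.
    exact: ER.
  - by subst y; apply: nxz.
  have Ryx : R y x by apply: ER => //; exact: sE.
  have nRxz : ~ R x z by move=> h; apply: nxz; left.
  have [s fs sx] := trans Dx Dy.
  have Dsz : D (s z) by apply/(locus_auto lD).
  have hyz : H y (s z) by rewrite -sx (eqv_inv eH fs).
  have nR : ~ R y (s z) by rewrite -sx (auto2 _ _ dR fs).
  have qyz : q y (s z) by rewrite -sx (auto2 _ _ dq fs).
  have nyx : ~ H y x by move=> h; apply: nxy; exact: sH.
  have := sep H y (s z) x eH Dy Dsz Dx hyz nyx => -[/(_ qyx) h _].
  by apply: nR; apply: (Rconv y (s z) x).
move=> x y z Dx Dy Dz xy yz; apply: contrapT => nxz.
have nexy : x <> y by move=> e; subst y; exact: nxz.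
have neyz : y <> z by move=> e; subst z; exact: nxz.
have nexz : x <> z by move=> e; subst z; apply: nxz; left; exact: Rr.
have [H eH [[h1 h2]|[h1 h2]]] := sym_separated dE sE Dx Dy Dx Dz nexy nexz xy nxz; last first.
  exact: C1 eH Dx Dy Dz xy yz nxz h2 h1.
have [H' eH' [[h1' h2']|[h1' h2']]] := sym_separated dE sE Dy Dz Dx Dz neyz nexz yz nxz; last first.
  case: (eH') => _ sH' tH' _ _.
  apply: (C1 H' z y x) => //; try exact: sE.
  - by move=> h; apply: nxz; exact: (sE _ _ Dz Dx h).
  - exact: sH'.
  - by move=> h; apply: h1'; exact: sH'.
case: (eH) => _ sH tH _ _; case: (eH') => _ sH' tH' _ _.
apply: h2; apply: (tH x y z) => //.
apply: (convex_eqv_chain eH eH' Dx Dy) => //.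
by move=> h; apply: h2'; exact: tH' h h1'.
Qed.

End Simple.

Lemma noshift_simple (K : Type) (L : signature) (M : structure L)
    (lt : M -> M -> Prop) :
  small_set K [set: formula L nat] -> saturated K M -> strongly_homogeneous K M ->
  linear_order_on [set: M] lt -> dfn2 set0 lt ->
  (forall S A, semiintervals lt S -> dfn2 A S -> forall a, ~ is_shift S a) ->
  theory_simple_semiintervals K M.
Proof.
move=> sl Ms Mh O dlt0 ns p _ B AB q sB cq _ ltp [_ oD r2 w] a S [cS mS rS].
pose D := realizations q; have lD : locus B D by exact: locus_realizations.
have [q0 dq eq0] := (rel_definable2P _ _ _).1 r2.
have [X dX eS] := (rel_definable1P _ _ _).1 rS.
have [R dR eR] := dfn_param dX.
have dlt : dfn2 B lt by apply: dfn_mono dlt0.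
have {}eS : S = R a `&` D by rewrite eS predeqE => x; split=> -[/eR].
subst S; have Da : D a by case: mS => -[].
have oD0 : linear_order_on D q0.
  case: oD => o1 o2 o3; split=> [x Dx /(eq0 _ _ Dx Dx)|x y z Dx Dy Dz|x y Dx Dy].
  - exact: o1.
  - move=> /(eq0 _ _ Dx Dy) h1 /(eq0 _ _ Dy Dz) h2; apply/(eq0 _ _ Dx Dz).
    exact: o2 h1 h2.
  - case: (o3 x y Dx Dy) => h; [constructor 1|constructor 2|constructor 3] => //;
      exact/eq0.
have oDl : linear_order_on D lt.
  by case: O => o1 o2 o3; split=> *; [exact: o1|apply: o2; eauto|exact: o3].
(* The order of the pair is arbitrary; weak o-minimality is transferred from it to [lt]. *)
have fcuD A Y : dfn1 A Y -> finite_convex_union D lt (Y `&` D).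
  apply: (fcu_locus sl Mh sB lD dq dlt oD0 oDl) => A' Y' dY'.
  apply: (fcu_eq_order eq0); apply: (w A') => [x []//|].
  by apply/rel_definable1P; exists Y'.
(* The automorphisms fixing [B] spread the given semiinterval at [a] over all of [D]. *)
have hR b : D b -> convex_in D q0 (R b `&` D) /\ is_min q0 (R b `&` D) b.
  move=> Db; have [s fs sa] := locus_trans sl Mh sB lD Da Db; subst b.
  have [s' [fs' sK s'K]] := fixes_inv fs; have [hs sB'] := fs.
  have Ds x : D (s' x) <-> D x by exact: (locus_auto lD x fs').
  have R2 x : R (s a) x <-> R a (s' x).
    by rewrite -{1}(s'K x); exact: dfn2_auto dR hs sB'.
  have q2 x y : D x -> D y -> q0 x y <-> ltp (s' x) (s' y).
    move=> Dx Dy; rewrite eq0; [|exact/Ds|exact/Ds].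
    by rewrite -{1}(s'K x) -{1}(s'K y); exact: dfn2_auto dq hs sB'.
  case: cS => _ cS; case: mS => mS1 mS2; split; split.
  - by move=> x [].
  - move=> x y z [/R2 Rx Dx] Dy [/R2 Rz Dz] /q2 xy /q2 yz.
    suff [h _] : (R a `&` D) (s' y) by split=> //; apply/R2.
    by apply: (cS (s' x) _ (s' z)); [split=> //; exact/Ds|exact/Ds|split=> //; exact/Ds|exact: xy|exact: yz].
  - by split=> //; apply/R2; rewrite sK; case: mS1.
  - move=> x [/R2 Rx Dx]; have [|e|h] := mS2 (s' x); first by split=> //; exact/Ds.
      by left; rewrite e s'K.
    by right; apply/q2 => //; rewrite sK.
have tr := simple_of_noshift sl Ms Mh O sB lD dlt (fun S Ss dS => ns S B Ss dS) fcuD dq oD0 dR hR.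
have dE : dfn2 B (fun x y => R x y \/ R y x) by rewrite /dfn2; dfn.
exists (fun x y => R x y \/ R y x).
  split=> //; last by apply/rel_definable2P; exists (fun x y => R x y \/ R y x).
  - by move=> x Dx; left; have [_ [[]]] := hR x Dx.
  - by move=> x y _ _ []; [right|left].
rewrite predeqE => x; split=> [[Rx Dx]|[Dx h [<-|h']]].
- by split=> //; [left|case: mS => _; apply].
- by case: mS.
- split=> //; case: h => // Rxa; case: oD0 => o1 o2 _.
  have [_ [_ /(_ a (conj Rxa Da)) [e|h]]] := hR x Dx; first by rewrite e in Rxa *.
  case: (o1 a) => //; apply: o2 h => //; exact/eq0.
Qed.

(** * A shift yields a non-simple semiinterval *)

(** The parameter set of a definable family is arbitrary, whereas compactness and homogeneity are
    available over small sets. *)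
Lemma dfn2_finite (L : signature) (M : structure L) (A : set M) R :
  dfn2 A R -> exists2 A' : set M, finite_set A' & dfn2 A' R.
Proof.
move=> [phi h]; have [F fF hF] := sat_support M phi.
have [a0] := carrier_inhabited M.
pose par (w : nat + {c | A c}) := match w with inl _ => a0 | inr c => sval c end.
exists (par @` F); first exact: finite_image.
pose g (w : nat + {c | A c}) : nat + {c | (par @` F) c} :=
  match w with
  | inl n => inl n
  | inr c => if pselect ((par @` F) (sval c)) is left e then inr (exist _ (sval c) e)
             else inl 0%N
  end.
exists (rename g phi) => v; rewrite h sat_rename; apply: hF => -[n|c] //= Fc.
by case: pselect => // n; case: n; exists (inr c).
Qed.

(** A [0]-definable set contains [D] or misses it, so that only the convex sets in the Boolean
    combination matter on [D]. *)
Lemma wqom_locus (L : signature) (M : structure L) (lt : M -> M -> Prop) B D :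
  linear_order_on [set: M] lt ->
  (forall A X : set M, definable1 A X -> boolean_combination
     [set Y | definable1 set0 Y \/ convex_in setT lt Y] X) ->
  locus B D -> forall A X, dfn1 A X -> finite_convex_union D lt (X `&` D).
Proof.
move=> O w [lD _] A X /definable1P /w.
elim=> {X} [X [/definable1P dX|cX]|X _ IH|X Y _ IH1 _ IH2].
- have dX' : dfn1 B X by apply: dfn_mono dX.
  apply: fcu_convex; split=> [x []//|x y z [Xx Dx] Dy _ _ _]; split=> //.
  exact: lD dX' Dx Dy Xx.
- apply: fcu_convex; split=> [x []//|x y z [Xx Dx] Dy [Xz _] xy yz].
  by split=> //; case: cX => _ c; exact: (c x y z).
- suff -> : ~` X `&` D = D `\` (X `&` D) by exact: fcuC.
  rewrite predeqE => x; split=> [[n Dx]|[Dx n]]; first by split=> // -[].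
  by split=> // Xx; apply: n.
- by rewrite setIUl; exact: fcuU.
Qed.

(** * Cofinal sets in [Pi], the union [reach] of the powers *)

Section Cofinal.
Variables (T : Type) (lt : T -> T -> Prop) (S : T -> set T) (a : T).
Hypothesis O : linear_order_on [set: T] lt.
Hypothesis Ss : semiintervals lt S.
Hypothesis mono : forall x t y, S x y -> ~ lt t x -> ~ lt y t -> S t y.
Hypothesis shift : is_shift S a.

Definition reach : set T := [set x | exists n, spower S a n x].

Definition cofinal (X : set T) :=
  forall z, reach z -> exists x, [/\ X x, reach x & ~ lt x z].

Lemma reach_step x y : reach x -> S x y -> reach y.
Proof. by move=> [n h] xy; exists n.+1; exists x. Qed.

Lemma reach_power x n y : reach x -> spower S x n y -> reach y.
Proof.
elim: n y => [|n IH] y ox /=; first exact: reach_step.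
by move=> [t /(IH _ ox)]; exact: reach_step.
Qed.

Lemma reach_start : reach a.
Proof. by exists 0%N; apply: (semi_refl Ss). Qed.

Lemma cofinalT : cofinal setT.
Proof. by move=> z oz; exists z; split=> //; exact: (lo_irr O). Qed.

Lemma cofinal_sub X Y : X `<=` Y -> cofinal X -> cofinal Y.
Proof. by move=> XY cX z /cX [x [Xx ox xz]]; exists x; split=> //; exact: XY. Qed.

Lemma cofinalU X Y : cofinal (X `|` Y) -> cofinal X \/ cofinal Y.
Proof.
move=> c; have [|/existsNP [z /not_implyP [oz nz]]] := pselect (cofinal X); first by left.
right=> u ou.
have [v [ov zv uv]] : exists v, [/\ reach v, ~ lt v z & ~ lt v u].
  have irr := lo_irr O.
  by have [h|h] := pselect (lt z u); [exists u|exists z]; split=> //; ord O.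
have [x [[Xx|Yx] ox xv]] := c v ov.
  by case: nz; exists x; split=> //; ord O.
by exists x; split=> //; ord O.
Qed.

Lemma cofinal_bigcup m (C : 'I_m -> set T) :
  cofinal (\bigcup_i C i) -> exists i, cofinal (C i).
Proof.
elim: m C => [|m IH] C c; first by have [x [[[]]]] := c a reach_start.
suff e : \bigcup_i C i = C ord0 `|` \bigcup_i C (lift ord0 i).
  move: c; rewrite e => /cofinalU [|/IH [i]]; first by exists ord0.
  by exists (lift ord0 i).
rewrite predeqE => x; split.
  by move=> [i _ h]; case: (unliftP ord0 i) h => [j|] -> h; [right; exists j|left].
by move=> [h|[i _ h]]; [exists ord0|exists (lift ord0 i)].
Qed.

Lemma reach_outside n : exists2 z, reach z & ~ spower S a n z.
Proof.
have [_ h] := shift n; apply: contrapT => no; apply: h => x ax.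
by apply: contrapT => nx; apply: no; exists x => //; exists n.+1.
Qed.

Lemma power_from x n y : ~ lt x a -> ~ lt y x -> spower S a n y -> spower S x n y.
Proof.
move=> ax; elim: n y => [|n IH] y xy; first by move=> ay; exact: mono ay _ _.
move=> [t at_ ty]; have [tx|tx] := pselect (lt t x); last first.
  by exists t => //; exact: IH.
apply: (spower_le Ss (m := 0) (leq0n _)).
by apply: mono ty _ _; ord O.
Qed.

Lemma cofinal_beyond X x : cofinal X -> reach x ->
  exists w, [/\ X w, reach w, lt x w & ~ S x w].
Proof.
move=> cX [n ax]; have [z oz nz] := reach_outside n.+1.
have [w [Xw ow zw]] := cX z oz.
have za : ~ lt z a by case: oz => m /(spower_ge O Ss).
have nw : ~ spower S a n.+1 w.
  by move=> h; apply: nz; exact: (spower_down O Ss h za).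
have nS : ~ S x w by move=> xw; apply: nw; exists x.
exists w; split=> //; apply: contrapT => xw; apply: nw.
apply: (spower_sub Ss); apply: (spower_down O Ss ax) => //; ord O.
Qed.

Variable X0 : set T.
Hypothesis cX0 : cofinal X0.

(** [S x] prolonged to the infimum of the upper ends of the sets [S w], where [w] runs over the
    points of [X0] beyond [S x]. The quantifier over [w] is there because a first such point may not
    exist. *)
Definition jump (x : T) : set T := [set y | ~ lt y x /\
  (S x y \/ forall w, X0 w -> lt x w /\ ~ S x w -> ~ lt y w -> S w y)].

Lemma jump_semiintervals : semiintervals lt jump.
Proof.
move=> x; split; [split=> // u v w [hu hu'] _ [hw hw'] uv vw|split].
- split; first by ord O.
  case: hw' => h; first by left; apply: (semi_down O Ss h); ord O.
  right=> t Xt xt vt; have tw : ~ lt w t by ord O.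
  by apply: (semi_down O Ss (h t Xt xt tw)); ord O.
- by split; [exact: (lo_irr O)|left; exact: (semi_refl Ss)].
- by move=> y [/(lo_nlt O) [->|]]; [left|right].
Qed.

(** Choose [w] in [X0] outside [S x] and in the least possible power of [S x]; it is one step away
    from some [t] in the preceding power. By minimality all points of [X0] beyond [S x] are above
    [t], so by [mono] those up to [w] have [w] in their sets. *)
Lemma jump_escapes x : reach x -> ~ lt x a ->
  exists w, [/\ X0 w, reach w, lt x w, jump x w & ~ S x w].
Proof.
move=> ox xa; have [w0 [Xw0 ow0 xw0 nw0]] := cofinal_beyond cX0 ox.
pose esc k := exists w, [/\ X0 w, spower S x k w & ~ S x w].
have exk : exists k, `[< esc k >].
  case: (ow0) => m aw0; exists m; apply/asboolP; exists w0; split=> //.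
  by apply: power_from aw0 => //; ord O.
have [k [w [Xw xw nw]] mink] : exists2 k, esc k & forall j, (j < k)%N -> ~ esc j.
  exists (ex_minn exk); case: ex_minnP => k /asboolP // ek hk.
  by move=> j jk ej; move: jk; rewrite ltnNge hk //; exact/asboolP.
have wx := spower_ge O Ss xw.
have lxw : lt x w.
  by apply: contrapT => h; apply: nw; have -> : w = x; [ord O|exact: (semi_refl Ss)].
exists w; split=> //; first exact: reach_power ox xw.
split=> //; right=> w' Xw' [xw' nw'] ww'.
case: k xw mink => [//|k] [t xt tw] mink.
have lt_t : lt t w'.
  apply: contrapT => h; apply: (mink k) => //; exists w'; split=> //.
  by apply: (spower_down O Ss xt); ord O.
by apply: mono tw _ _; ord O.
Qed.

(* Iterating [jump_escapes] inside [jump x0] leaves every power of [S] at [x0],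
   whereas [jump x0] is contained in one of them. *)
Lemma jump_not_transitive z0 : reach z0 ->
  ~ forall x y z, X0 x -> X0 y -> X0 z -> reach x -> reach y -> reach z ->
      ~ lt x z0 -> ~ lt y z0 -> ~ lt z z0 ->
      jump x y -> jump y z -> jump x z.
Proof.
move=> oz0 tr.
have oge x : reach x -> ~ lt x a by move=> [n /(spower_ge O Ss)].
have [x0 [Xx0 ox0 zx0]] := cX0 oz0.
have ax0 := oge _ ox0.
have H i : exists w, [/\ X0 w, reach w, ~ lt w x0, jump x0 w & ~ spower S x0 i w].
  elim: i => [|i [x [Xx ox xx0 jx nx]]].
    have [w [h1 h2 h3 h4 h5]] := jump_escapes ox0 ax0.
    by exists w; split=> //; ord O.
  have [w [h1 h2 h3 h4 h5]] := jump_escapes ox (oge _ ox).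
  exists w; split=> //; first by ord O.
    by apply: (tr x0 x w) => //; ord O.
  move=> [t x0t tw]; apply: h5; apply: mono tw _ _; last by ord O.
  move=> xt; apply: nx; apply: (spower_down O Ss x0t) => //; ord O.
have [w0 [Xw0 ow0 xw0 nw0]] := cofinal_beyond cX0 ox0.
have [m hm] : exists m, spower S x0 m w0.
  by case: (ow0) => m h; exists m; apply: power_from h => //; ord O.
have [x [Xx ox xx0 [_ jx] nx]] := H m.+1; apply: nx.
case: jx => [h|h]; first exact: (spower_le Ss (m := 0) (leq0n _)).
have [xw|xw] := pselect (lt x w0).
  by apply: (spower_sub Ss); apply: (spower_down O Ss hm) => //; ord O.
by exists w0 => //; apply: h.
Qed.

End Cofinal.

(** * The limit type of [X0] at the end of [Pi] *)

Section LimitType.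
Variables (K : Type) (L : signature) (M : structure L).
Hypothesis small_language : small_set K [set: formula L nat].
Hypothesis Msat : saturated K M.
Hypothesis Mhom : strongly_homogeneous K M.
Variables (lt : M -> M -> Prop) (S : M -> set M) (a : M).
Hypothesis O : linear_order_on [set: M] lt.
Hypothesis dlt0 : dfn2 set0 lt.
Hypothesis Ss : semiintervals lt S.
Hypothesis mono : forall x t y, S x y -> ~ lt t x -> ~ lt y t -> S t y.
Hypothesis shift : is_shift S a.
Hypothesis wom : forall B D, small_set K B -> locus B D ->
  forall A X, dfn1 A X -> finite_convex_union D lt (X `&` D).
Variable X0 : set M.
Hypothesis cX0 : cofinal lt S a X0.

Let cof := cofinal lt S a.

(** That is, [Y] contains a final part of [X0] in [Pi]. *)
Definition almost (Y : set M) := ~ cof (X0 `\` Y).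

Definition unsplittable (A : set M) :=
  forall Y, dfn1 A Y -> almost Y \/ almost (~` Y).

Definition limit_locus (A : set M) : set M :=
  [set x | forall Y, dfn1 A Y -> almost Y -> Y x].

Lemma almostI X Y : almost X -> almost Y -> almost (X `&` Y).
Proof. by rewrite /almost setDIr => h1 h2 /(cofinalU O) []. Qed.

Lemma cofinal_almost X Y : cof X -> X `<=` X0 -> almost Y -> cof (X `&` Y).
Proof.
move=> cX XX0 aY.
have : cof ((X `&` Y) `|` (X `\` Y)).
  apply: cofinal_sub cX => x Xx.
  by have [Yx|nY] := pselect (Y x); [left|right].
move=> /(cofinalU O) [//|h]; case: aY; apply: cofinal_sub h.
by move=> x [/XX0].
Qed.

Lemma almost_nonempty Y : almost Y -> exists x, Y x.
Proof.
move=> /(cofinal_almost cX0 (@subset_refl _ X0)) h.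
by have [x [[_ Yx] _ _]] := h a (reach_start a Ss); exists x.
Qed.

Lemma limit_nonempty A : small_set K A -> exists x, limit_locus A x.
Proof.
move=> sA.
pose F := [set Y | dfn1 A Y /\ almost Y].
have FT : F setT.
  split; first exact: dfn_true.
  rewrite /almost setDT => h.
  by have [x [[]]] := h a (reach_start a Ss).
have [|||x hx] := @saturated_directed _ _ _ Msat A F setT sA FT.
- by move=> X [].
- by move=> X [_ /almost_nonempty].
- move=> X Y [dX aX] [dY aY]; exists (X `&` Y) => //.
  by split; [exact: dfn_and|exact: almostI].
by exists x => Y dY aY; apply: hx.
Qed.

Lemma limit_locusP A : unsplittable A -> locus A (limit_locus A).
Proof.
move=> uA; split=> [X x y dX Dx Dy Xx|x h Y dY aY]; last first.
  by apply: h => // z; apply.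
have [aX|aX] := uA X dX; first exact: Dy.
have dnX : dfn1 A (~` X) by rewrite /dfn1 /=; apply: dfn_not.
by case: (Dx _ dnX aX Xx).
Qed.

Lemma nbd_almost A X : small_set K A -> unsplittable A ->
  nbd A (limit_locus A) X -> almost X.
Proof.
move=> sA uA [dX DX]; have [//|aX] := uA X dX.
have [x Dx] := limit_nonempty sA.
have dnX : dfn1 A (~` X) by rewrite /dfn1 /=; apply: dfn_not.
by case: (Dx _ dnX aX (DX _ Dx)).
Qed.

(** Weak o-minimality holds on the limit locus over the empty set. If [X] split [X0] into two
    cofinal pieces, [X] and its complement would alternate arbitrarily often in every neighbourhood
    of that locus, and by compactness in the locus itself. *)
Lemma unsplittable_all B : small_set K B -> unsplittable set0 -> unsplittable B.
Proof.
move=> sB u0 X dX; apply: contrapT => /not_orP [/contrapT c1 /contrapT c2].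
rewrite setDE setCK -/cof in c2; rewrite -/cof in c1.
have s0 : small_set K (set0 : set M) by apply: (small_finite small_language).
have l0 := limit_locusP u0.
have B0 : (set0 : set M) `<=` B by [].
have dlt : dfn2 B lt by apply: dfn_mono dlt0.
have dnX : dfn1 B (~` X) by rewrite /dfn1 /=; apply: dfn_not.
have unb Y n : nbd set0 (limit_locus set0) Y ->
    exists y, alt lt (Y `&` X) (Y `&` ~` X) n y.
  move=> /(nbd_almost s0 u0) aY.
  pose P := [set x | [/\ X0 x, X x, Y x & reach S a x]].
  pose Q := [set x | [/\ X0 x, ~ X x, Y x & reach S a x]].
  have toP z : reach S a z -> exists2 x, P x & ~ lt x z.
    have c : cof ((X0 `&` X) `&` Y) by apply: cofinal_almost => // x [].
    by move=> /c [x [[[h1 h2] h3] h4 h5]]; exists x.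
  have toQ z : reach S a z -> exists2 x, Q x & ~ lt x z.
    have c : cof ((X0 `\` X) `&` Y) by apply: cofinal_almost => // x [].
    by move=> /c [x [[[h1 h2] h3] h4 h5]]; exists x.
  have [w Pw _] := toP _ (reach_start a Ss).
  have [||y h] := alt_unbounded O Pw _ _ n (Q := Q).
  - by move=> x [_ _ _ /toQ].
  - by move=> x [_ _ _ /toP].
  by exists y; apply: (alt_sub O) h => x _ [].
have [n hn] := fcu_alt O (wom s0 l0 dX).
have [|||y Dy hy] := locus_compact Msat l0 (C := B)
   (Y := fun Y => [set y | alt lt (Y `&` X) (Y `&` ~` X) n y]) sB B0.
- move=> Y [dY _]; have dY' := dfn_mono B0 dY.
  by apply: alt_dfn1 => //; apply: dfn_and.
- by move=> Y Y' YY' y; apply: (alt_sub O) => x _ [/YY'].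
- move=> Y nY; have [y /(alt_top O) [t [_ [Yt _] ht]]] := unb Y n nY.
  by exists t.
have := alt_compact small_language Msat l0 dlt0 O sB B0 dX dnX hy.
apply: (hn _ _ n y _ _ (leqnn n)).1; first by move=> x [].
by move=> x [Dx nX]; split=> // -[].
Qed.

Variable B : set M.
Hypothesis sB : small_set K B.
Hypothesis uB : unsplittable B.
Hypothesis dS : dfn2 B S.
Hypothesis dX0 : dfn1 B X0.

Let D := limit_locus B.

Definition limit_type : set (formulaA B 1) := [set phi | almost (fdef phi)].

Lemma limit_type_complete : complete_types B 1 limit_type.
Proof.
split=> [q qp _|phi].
  have [x Dx] := limit_nonempty sB; exists (fun=> x) => phi /qp h.
  exact: (Dx _ (dfn1_fdef phi) h).
exact: (uB (dfn1_fdef phi)).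
Qed.

Lemma realizations_limit_type : realizations limit_type = D.
Proof.
rewrite predeqE => x; split=> [h Y dY aY|h phi aphi].
  have [phi e] := fdef_dfn1 dY; rewrite -e; apply: h.
  by rewrite /limit_type /= e.
exact: (h _ (dfn1_fdef phi) aphi).
Qed.

(** If the semiinterval given by [jump] at a realization were determined, [jump] would be transitive
    on [D], then by compactness on a neighbourhood of [D], and so on a final part of [X0], against
    [jump_not_transitive]. *)
Lemma limit_type_not_simple : ~ simple_semiintervals limit_type.
Proof.
move=> simple; have lD := limit_locusP uB; rewrite -/D in lD.
have dlt : dfn2 B lt by apply: dfn_mono dlt0.
pose J x y := ~ lt y x /\
  (S x y \/ forall w, X0 w -> lt x w /\ ~ S x w -> ~ lt y w -> S w y).
have dJ : dfn2 B J by rewrite /dfn2 /J; dfn.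
have Js : semiintervals lt J by exact: jump_semiintervals.
have eJ : J = jump lt S X0 by [].
clearbody J.
have [x0 Dx0] := limit_nonempty sB.
have [q1 q2 q3] : linear_order_on D lt.
  by case: O => o1 o2 o3; split=> [x _|x y z _ _ _|x y _ _]; [exact: o1|exact: o2|exact: o3].
have pair : weakly_o_minimal_pair limit_type lt.
  split; rewrite ?realizations_limit_type //.
  - exact: limit_type_complete.
  - by apply/rel_definable2P; exists lt.
  - move=> A X XD /rel_definable1P [X' dX' ->]; exact: wom sB lD _ _ dX'.
have [E hE eE] : determined limit_type lt x0 (J x0 `&` D).
  apply: simple => //; split; rewrite ?realizations_limit_type.
  - have [[_ c] _] := Js x0; split=> [x []//|x y z [h1 h2] Dy [h3 h4] xy yz].
    by split=> //; exact: (c x y z).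
  - have [_ [h1 h2]] := Js x0; split=> // x [/h2].
    by [].
  - apply/rel_definable1P; exists (J x0) => //.
    have C0 : (B `|` [set x0]) x0 by right.
    have dJ' : dfn2 (B `|` [set x0]) J by apply: dfn_mono dJ => x; left.
    by rewrite /dfn1; dfn.
rewrite realizations_limit_type in eE.
move: hE; rewrite /rel_definable_equivalence realizations_limit_type /=.
move=> [E1 E2 E3 /rel_definable2P [E' dE' eE']].
(* Automorphisms transport the description of [J x0] to every point of [D]. *)
have JE y z : D y -> D z -> (J y z <-> E y z /\ ~ lt z y).
  move=> Dy Dz; have [s fs e] := locus_trans small_language Mhom sB lD Dx0 Dy.
  have [s' [fs' sK s'K]] := fixes_inv fs; have [hs' sB'] := fs'.
  have s'y : s' y = x0 by rewrite -e sK.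
  have Dsz : D (s' z) by apply/(locus_auto lD _ fs').
  have -> : J y z <-> J x0 (s' z).
    by rewrite -s'y; apply: iff_sym; exact: dfn2_auto dJ hs' sB'.
  have -> : E y z <-> E x0 (s' z).
    by rewrite !eE' // -s'y; apply: iff_sym; exact: dfn2_auto dE' hs' sB'.
  have -> : lt z y <-> lt (s' z) x0.
    by rewrite -s'y; apply: iff_sym; exact: dfn2_auto dlt hs' sB'.
  move: eE; rewrite predeqE => /(_ (s' z)) /= eE; split=> h.
    have [_ h1 h2] := eE.1 (conj h Dsz); split=> //.
    by case: h2 => [->|]; [exact: (lo_irr O)|exact: lo_asym].
  have [] // := eE.2 _; split=> //; first by case: h.
  by case: h => _ /(lo_nlt O) [->|]; [left|right].
have tr x y z : D x -> D y -> D z -> J x y -> J y z -> J x z.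
  move=> Dx Dy Dz /(JE _ _ Dx Dy) [e1 h1] /(JE _ _ Dy Dz) [e2 h2].
  by apply/(JE _ _ Dx Dz); split; [exact: E3 e1 e2|ord O].
pose bad x y z := J x y /\ J y z /\ ~ J x z.
(* Failures of transitivity in all neighbourhoods would produce one in [D], by three applications of
   compactness, one for each of the three points. *)
have [Y nY hY] : exists2 Y, nbd B D Y &
    forall x y z, Y x -> Y y -> Y z -> J x y -> J y z -> J x z.
  apply: contrapT => no.
  have hbad Y : nbd B D Y -> exists x, Y x /\ exists y, Y y /\ exists z, Y z /\ bad x y z.
    move=> nY; apply: contrapT => nb; apply: no; exists Y => // x y z Yx Yy Yz xy yz.
    apply: contrapT => nxz; apply: nb; exists x; split=> //; exists y; split=> //.
    by exists z.
  have [|||x Dx hx] := locus_compact Msat lD (C := B)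
    (Y := fun Y => [set x | exists y, Y y /\ exists z, Y z /\ bad x y z]) sB (@subset_refl _ B).
  - by move=> Y [dY _]; rewrite /dfn1 /= /bad; dfn.
  - by move=> Y Y' YY' x [y [/YY' Yy [z [/YY' Yz h]]]]; exists y; split=> //; exists z.
  - by move=> Y /hbad [x [Yx h]]; exists x.
  have Cx : (B `|` [set x]) x by right.
  have BC : B `<=` B `|` [set x] by move=> t; left.
  have dJ' := dfn_mono BC dJ.
  have sC := small_setU1 small_language (a := x) sB.
  have [|||y Dy hy] := locus_compact Msat lD
    (Y := fun Y => [set y | exists z, Y z /\ bad x y z]) sC BC.
  - move=> Y [dY _]; have dY' := dfn_mono BC dY.
    by rewrite /dfn1 /= /bad; dfn.
  - by move=> Y Y' YY' y [z [/YY' Yz h]]; exists z.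
  - by move=> Y /hx [y [Yy h]]; exists y.
  have BC' : B `<=` (B `|` [set x]) `|` [set y] by move=> t; left; left.
  have Cx' : ((B `|` [set x]) `|` [set y]) x by left; right.
  have Cy' : ((B `|` [set x]) `|` [set y]) y by right.
  have dJ'' := dfn_mono BC' dJ.
  have sC' := small_setU1 small_language (a := y) sC.
  have [|||z Dz hz] := locus_compact Msat lD (Y := fun Y => [set z | bad x y z]) sC' BC'.
  - by move=> Y [dY _]; rewrite /dfn1 /= /bad; dfn.
  - by move=> Y Y' YY' z.
  - by move=> Y /hy [z [Yz h]]; exists z.
  have [xy [yz nxz]] := hz _ (nbdT B D).
  by apply: nxz; exact: tr xy yz.
have /existsNP [z0 /not_implyP [oz0 hz0]] := nbd_almost sB uB nY.
apply: (@jump_not_transitive _ lt S a O Ss mono shift X0 cX0 z0 oz0).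
rewrite -eJ => x y z Xx Xy Xz ox oy oz xz yz zz; apply: hY.
all: by apply: contrapT => n; apply: hz0; eexists; split; [split; [|exact: n]| |].
Qed.

End LimitType.

(** * Existence of an unsplittable cofinal set *)

Section Unsplit.
Variables (K : Type) (L : signature) (M : structure L).
Hypothesis small_language : small_set K [set: formula L nat].
Hypothesis Msat : saturated K M.
Variables (lt : M -> M -> Prop) (S : M -> set M) (a : M).
Hypothesis O : linear_order_on [set: M] lt.
Hypothesis dlt0 : dfn2 set0 lt.
Hypothesis Ss : semiintervals lt S.
Hypothesis shift : is_shift S a.

Let cof := cofinal lt S a.

Let splitN X : ~ unsplittable lt S a X set0 ->
  exists Y, [/\ dfn1 set0 Y, cof (X `\` Y) & cof (X `&` Y)].
Proof.
move=> /existsNP [Y /not_implyP [dY /not_orP [/contrapT c1 /contrapT c2]]].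
by exists Y; rewrite setDE setCK in c2.
Qed.

(* Otherwise one could successively avoid all the countably many types. *)
Lemma unsplittable_small_theory : small_theory M ->
  exists X, [/\ dfn1 set0 X, cof X & unsplittable lt S a X set0].
Proof.
move=> /(_ 1%N) /countable_injP [f finj]; apply: contrapT => no.
pose tp x : set (formulaA (set0 : set M) 1) := [set phi | satA phi (fun=> x)].
have ctp x : complete_types set0 1 (tp x).
  by split=> [q qp _|phi]; [exists (fun=> x)|exact: EM].
have fin_tp x y : f (tp x) = f (tp y) -> tp x = tp y.
  by apply: finj; rewrite inE; exact: ctp.
pose good X := dfn1 (set0 : set M) X /\ cof X.
(* Points of the same type lie on the same side of a [0]-definable set, so one of the two cofinal
   pieces of [X] avoids the type with number [n]. *)
have step (Xn : {X | good X} * nat) : exists X' : {X | good X},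
    sval X' `<=` sval Xn.1 /\ forall x, sval X' x -> f (tp x) <> Xn.2.
  case: Xn => -[X [dX cX]] n /=.
  have [Y [dY c1 c2]] : exists Y, [/\ dfn1 set0 Y, cof (X `\` Y) & cof (X `&` Y)].
    by apply: splitN => u; apply: no; exists X.
  have g1 : good (X `\` Y).
    by split=> //; apply: dfn_and dX _; apply: dfn_not dY.
  have g2 : good (X `&` Y) by split=> //; apply: dfn_and dX dY.
  have [[x [[Xx Yx] fx]]|nx] := pselect (exists x, (X `&` Y) x /\ f (tp x) = n).
    exists (exist _ _ g1) => /=; split=> [z []//|z [Xz nYz] fz]; apply: nYz.
    have [phi e] := fdef_dfn1 dY.
    have : tp x phi by rewrite -e in Yx.
    by rewrite (fin_tp x z) ?fx ?fz // -e.
  exists (exist _ _ g2) => /=; split=> [z []//|z XYz fz].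
  by apply: nx; exists z.
have [g hg] := choice step.
have gT : good setT by split; [exact: dfn_true|exact: (cofinalT O)].
pose X_ := fix X_ n := if n is m.+1 then g (X_ m, m) else exist good setT gT.
have mon m n : (m <= n)%N -> sval (X_ n) `<=` sval (X_ m).
  elim: n => [|n IH]; first by rewrite leqn0 => /eqP ->.
  rewrite leq_eqVlt => /orP [/eqP -> //|]; rewrite ltnS => /IH h x.
  by move=> /(hg (X_ n, n)).1 /h.
have s0 : small_set K (set0 : set M) by exact: (small_finite small_language).
have [|||x hx] := @saturated_directed _ _ _ Msat set0
    [set X | exists n, X = sval (X_ n)] _ s0 (ex_intro _ 0%N erefl).
- by move=> X [n ->]; have [] := proj2_sig (X_ n).
- move=> X [n ->]; have [_ c] := proj2_sig (X_ n).
  by have [x [Xx _ _]] := c a (reach_start a Ss); exists x.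
- move=> X Y [m ->] [n ->]; exists (sval (X_ (maxn m n))); first by exists (maxn m n).
  by move=> x h; split; apply: mon h; [exact: leq_maxl|exact: leq_maxr].
apply: ((hg (X_ (f (tp x)), f (tp x))).2 x) => //.
by apply: (hx (sval (X_ (f (tp x)).+1))); exists (f (tp x)).+1.
Qed.

Variable lt1 : M -> M -> Prop.
Hypothesis O1 : linear_order_on [set: M] lt1.
Hypothesis dlt1 : dfn2 set0 lt1.
Hypothesis wom1 : weakly_o_minimal_wrt lt1.

(** The [lt1]-convex component of [b] in [C], in a form that is visibly definable over [b] and the
    parameters of [C]. *)
Let component (C : set M) b : set M :=
  [set x | forall z, (~ lt1 z b /\ ~ lt1 x z) \/ (~ lt1 z x /\ ~ lt1 b z) -> C z].

Let componentP C b : [/\ convex_in setT lt1 (component C b),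
  component C b `<=` C &
  forall X, convex_in setT lt1 X -> X b -> X `<=` C -> X `<=` component C b].
Proof.
have irr := lo_irr O1.
split.
- split=> // x y z hx _ hz xy yz w [[h1 h2]|[h1 h2]].
    by apply: hz; left; split=> //; ord O1.
  by apply: hx; right; split=> //; ord O1.
- move=> x; apply; have [h|h] := pselect (lt1 x b); [right|left]; split=> //; ord O1.
- move=> X cX Xb XC x Xx z [[h1 h2]|[h1 h2]]; apply: XC.
    exact: (convex_between O1 cX Xb I Xx).
  exact: (convex_between O1 cX Xx I Xb).
Qed.

(** Two orders are involved: convexity refers to [lt1], cofinality to [lt]. *)
Let good (X : set M) := [/\ exists2 A, finite_set A & dfn1 A X,
  convex_in setT lt1 X & cof X].

Let good_sub X Y : good X -> dfn1 set0 Y -> cof (X `&` Y) ->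
  exists2 X', good X' & X' `<=` X `&` Y.
Proof.
move=> [[A fA dX] cX _] dY c.
have dXY : dfn1 A (X `&` Y) by apply: dfn_and dX _; apply: dfn_mono dY.
have [m [C [cC e]]] := wom1 ((definable1P _ _).2 dXY).
rewrite e in c; have [i ci] := cofinal_bigcup O Ss c.
have [b [Cb _ _]] := ci a (reach_start a Ss).
have [h1 h2 h3] := componentP (X `&` Y) b.
exists (component (X `&` Y) b) => //; split=> //.
  exists (A `|` [set b]); first by rewrite finite_setU; split=> //; exact: finite_set1.
  have BC : A `<=` A `|` [set b] by move=> x; left.
  have Cb' : (A `|` [set b]) b by right.
  have dXY' := dfn_mono BC dXY.
  have dlt1' : dfn2 (A `|` [set b]) lt1 by apply: dfn_mono dlt1.
  by move: (X `&` Y) dXY' => Z dZ; rewrite /dfn1 /component /=; dfn.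
apply: cofinal_sub ci; apply: h3 => // x Cx.
by rewrite e; exists i.
Qed.

(** If all good sets could be split, repeated splitting would give, for large [y] in [Pi],
    arbitrarily long [lt1]-chains alternating between [P y] and [Q y]. Weak o-minimality for [lt1]
    bounds such chains uniformly in [y]. *)
Lemma unsplittable_weakly_o_minimal :
  exists X A, [/\ finite_set A, dfn1 A X, cof X & unsplittable lt S a X set0].
Proof.
apply: contrapT => no.
pose P y := [set x | lt x y]; pose Q y := [set x | ~ lt x y].
have irr := lo_irr O.
have grow m X : good X -> exists2 z, reach S a z &
    forall y, reach S a y -> ~ lt y z -> exists2 w, X w &
      alt lt1 (X `&` P y) (X `&` Q y) m w \/ alt lt1 (X `&` Q y) (X `&` P y) m w.
  have inside X' : good X' -> exists x z, [/\ X' x, reach S a z & lt x z].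
    move=> [_ _ c]; have [x [Xx [n ox] _]] := c a (reach_start a Ss).
    have [z oz nz] := reach_outside shift n; exists x, z; split=> //.
    apply: contrapT => xz; apply: nz; apply: (spower_down O Ss ox) => //.
    by case: oz => k /(spower_ge O Ss).
  elim: m X => [|m IH] X gX.
    have [x [z [Xx oz xz]]] := inside X gX; exists z => // y oy zy.
    exists x => //; left; apply: alt0; last exact: (lo_irr O1).
    by split=> //; rewrite /P /=; ord O.
  (* A chain in [X1] is continued by a point of [X2] on top: [x] lies in [P y] for all large [y],
     and cofinality of [X2] supplies a point [u] of [Q y]. *)
  have key X1 X2 : good X1 -> good X2 -> X1 `<=` X -> X2 `<=` X ->
      (forall x y, X1 x -> X2 y -> lt1 x y) -> exists2 z, reach S a z &
    forall y, reach S a y -> ~ lt y z -> exists2 w, X w &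
      alt lt1 (X `&` P y) (X `&` Q y) m.+1 w \/ alt lt1 (X `&` Q y) (X `&` P y) m.+1 w.
    move=> g1 g2 X1X X2X X12.
    have [z1 oz1 h1] := IH _ g1; have [x [z2 [X2x oz2 xz2]]] := inside _ g2.
    have [z [oz zz1 zz2]] : exists z, [/\ reach S a z, ~ lt z z1 & ~ lt z z2].
      by have [h|h] := pselect (lt z1 z2); [exists z2|exists z1]; split=> //; ord O.
    exists z => // y oy yz; have [|w X1w hw] := h1 y oy; first by ord O.
    have [_ _ c2] := g2; have [u [X2u _ uy]] := c2 y oy.
    have wx := X12 _ _ X1w X2x; have wu := X12 _ _ X1w X2u.
    case: hw => hw; [exists u|exists x]; try exact: X2X; [right|left].
      apply: (altS O1 (x := w)); [by split; first exact: X2X|exact: (lo_asym O1)|].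
      by apply: (alt_sub O1) hw => t _ [/X1X].
    apply: (altS O1 (x := w)); [|exact: (lo_asym O1)|].
      by split; [exact: X2X|rewrite /P /=; ord O].
    by apply: (alt_sub O1) hw => t _ [/X1X].
  have [Y [dY c1 c2]] : exists Y, [/\ dfn1 set0 Y, cof (X `\` Y) & cof (X `&` Y)].
    apply: splitN => u; apply: no; case: (gX) => -[A fA dX] _ cX.
    by exists X, A.
  have dnY : dfn1 set0 (~` Y) by rewrite /dfn1 /=; apply: dfn_not.
  have [X1 g1 s1] := good_sub gX dnY c1; have [X2 g2 s2] := good_sub gX dY c2.
  have disj x : X1 x -> X2 x -> False by move=> /s1 [_ n] /s2 [].
  have [_ v1 c1'] := g1; have [_ v2 c2'] := g2.
  have [x1 [Xx1 _ _]] := c1' a (reach_start a Ss).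
  have [x2 [Xx2 _ _]] := c2' a (reach_start a Ss).
  have sep X1' X2' x y x' y' : convex_in setT lt1 X1' -> convex_in setT lt1 X2' ->
      (forall x, X1' x -> X2' x -> False) ->
      X1' x -> X2' y -> X1' x' -> X2' y' -> lt1 x y -> lt1 x' y'.
    move=> w1 w2 d Xx Xy Xx' Xy' xy; apply: contrapT => n.
    have irr1 := lo_irr O1.
    have [h|h] := pselect (lt1 x y').
      by apply: (d y') => //; apply: (convex_between O1 w1 Xx I Xx'); ord O1.
    by apply: (d x) => //; apply: (convex_between O1 w2 Xy' I Xy); ord O1.
  case: (lo_tot O1 x1 x2) => h.
  - apply: (key X1 X2) => // [x /s1[]|x /s2[]|x y h1 h2] //.
    exact: (sep X1 X2 x1 x2).
  - by case: (disj x1) => //; rewrite h.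
  - apply: (key X2 X1) => // [x /s2[]|x /s1[]|x y h1 h2] //.
    by apply: (sep X2 X1 x2 x1) => // z ? ?; exact: (disj z).
have gT : good setT.
  split; [|by []|exact: (cofinalT O)].
  by exists set0; [exact: finite_set0|exact: dfn_true].
have s0 : small_set K (set0 : set M) by exact: (small_finite small_language).
(* Without a uniform bound, saturation would give a single [y] with chains of every length. *)
have [N hN] : exists N, forall y w, ~ alt lt1 (P y) (Q y) N w.
  apply: contrapT => nN.
  pose F n := [set y | exists w, alt lt1 (P y) (Q y) n w].
  have dF n : dfn1 set0 (F n).
    pose R y w := alt lt1 (P y) (Q y) n w.
    have dR : dfn2 set0 R.
      by apply: (alt_dfn (P := P) (Q := Q)) => //; rewrite /dfn2 /P /Q /=; dfn.
    by rewrite /dfn1 /F /= -/R; apply: dfn_ex; exact: (dfn2_at dR (dterm_var _ 1) (dterm_var _ 0)).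
  have [|||y hy] := @saturated_directed _ _ _ Msat set0
    [set X | exists n, X = F n] _ s0 (ex_intro _ 0%N erefl).
  - by move=> X [n ->].
  - move=> X [n ->]; apply: contrapT => no'; apply: nN; exists n => y w h.
    by apply: no'; exists y; exists w.
  - move=> X Y [m ->] [n ->]; exists (F (maxn m n)); first by exists (maxn m n).
    by move=> y [w h]; split; exists w; apply: alt_le h; [exact: leq_maxl|exact: leq_maxr].
  have dPy : definable1 [set y] (P y).
    apply/definable1P; rewrite /dfn1 /P /=.
    have Cy : [set y] y by [].
    have dlt' : dfn2 [set y] lt by apply: dfn_mono dlt0.
    by dfn.
  have [n hn] := fcu_alt O1 (wom1 dPy).
  have [w h] : F n y by apply: hy; exists n.
  by apply: (hn (P y) (Q y) n w _ _ (leqnn n)).1 h => // x; split.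
(* One more than [N], since the chain may have its top in [Q z]. *)
have [z oz hz] := grow N.+1 setT gT.
have [w _ h] := hz z oz (@irr z).
have [h1|h1] : alt lt1 (P z) (Q z) N.+1 w \/ alt lt1 (Q z) (P z) N.+1 w.
- by case: h; rewrite !setTI; [left|right].
- by apply: (hN z w); apply: alt_le h1.
- by apply: (hN z w); apply: (alt_pred O1) h1.
Qed.

End Unsplit.

(** * The two implications put together *)

Lemma shift_not_simple (K : Type) (L : signature) (M : structure L)
    (lt : M -> M -> Prop) :
  small_set K [set: formula L nat] -> saturated K M -> strongly_homogeneous K M ->
  linear_order_on [set: M] lt -> dfn2 set0 lt ->
  weakly_quasi_o_minimal M -> small_theory M \/ weakly_o_minimal M ->
  admits_shift lt -> ~ theory_simple_semiintervals K M.
Proof.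
move=> sl Ms Mh O dlt0 [ltq [Oq /definable2P dq] wq] sw.
move=> [S0 [[S1 S2 [A /definable2P /dfn2_finite [A1 fA1 dS0]]] [a sh0]]] simple.
have S0s : semiintervals lt S0 by move=> x; split.
(* The nondecreasing replacement of [S0]. Admitting starting points only from [a] on leaves the
   powers at [a] unchanged, as [pS] shows. *)
pose S x : set M := [set y | y = x \/ (~ lt y x /\ exists t, ~ lt t a /\ ~ lt x t /\ S0 t y)].
have irr := lo_irr O.
have Ss : semiintervals lt S.
  move=> x; split; [split=> // u v w hu _ hw uv vw|split].
  - have xu : ~ lt u x by case: hu => [->|[]].
    case: hw => [e|[wx [t [ta [xt tw]]]]]; first by exfalso; ord O.
    right; split; first by ord O.
    by exists t; do !split=> //; apply: (semi_down O S0s tw); ord O.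
  - by left.
  - by move=> y [->|[/(lo_nlt O) [->|]]]; [left|left|right].
have mono x t y : S x y -> ~ lt t x -> ~ lt y t -> S t y.
  move=> [->|[yx [u [ua [xu uy]]]]] xt ty; first by left; ord O.
  by right; split=> //; exists u; do !split=> //; ord O.
have pS n x : spower S a n x <-> spower S0 a n x.
  elim: n x => [|n IH] x /=.
    split=> [[->|[_ [t [ta [at_ tx]]]]]|ax]; first exact: (semi_refl S0s).
      by have <- : t = a; [ord O|].
    by right; split; [exact: (semi_ge O S0s)|exists a].
  split=> -[t /IH h].
    move=> [->|[xt [u [ua [tu ux]]]]]; first exact: (spower_sub S0s).
    by exists u => //; exact: (spower_down O S0s h).
  move=> tx; exists t => //; right; split; first exact: (semi_ge O S0s).
  exists t; split; [exact: (spower_ge O Ss h)|by split; first exact: irr].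
have sh : is_shift S a.
  move=> n; have [h1 h2] := sh0 n; split; first exact: (spower_sub Ss).
  by move=> h; apply: h2 => x /pS /h /pS.
have [X0 [A2 [fA2 dX0 cX0 uX0]]] : exists X A, [/\ finite_set A, dfn1 A X,
    cofinal lt S a X & unsplittable lt S a X set0].
  case: sw => [small|[lt1 [O1 /definable2P dlt1] w1]].
    have [X [dX cX uX]] := unsplittable_small_theory sl Ms a O Ss small.
    by exists X, set0.
  exact: (unsplittable_weakly_o_minimal sl Ms O dlt0 Ss sh O1 dlt1 w1).
pose B := (A1 `|` A2) `|` [set a].
have sB : small_set K B.
  by apply: (small_finite sl); rewrite !finite_setU; do !split=> //; exact: finite_set1.
(* Weak quasi-o-minimality is given for some order [ltq]; [fcu_locus] passes to [lt]. *)
have wom B' D : small_set K B' -> locus B' D ->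
    forall A' X, dfn1 A' X -> finite_convex_union D lt (X `&` D).
  move=> sB' lD; have sub lt' : linear_order_on [set: M] lt' -> linear_order_on D lt'.
    by move=> [o1 o2 o3]; split=> [x _|x y z _ _ _|x y _ _]; [exact: o1|exact: o2|exact: o3].
  apply: (fcu_locus sl Mh sB' lD (lt := ltq)); try exact: sub.
  - exact: dfn_mono dq.
  - exact: dfn_mono dlt0.
  - exact: wqom_locus Oq wq lD.
have dX0B : dfn1 B X0 by apply: dfn_mono dX0 => x; left; right.
have dSB : dfn2 B S.
  have Ca : B a by right.
  have d0 : dfn2 B S0 by apply: dfn_mono dS0 => x; left; left.
  have dl : dfn2 B lt by apply: dfn_mono dlt0.
  by rewrite /dfn2 /S /=; dfn.
have uB := unsplittable_all sl Ms O dlt0 Ss wom cX0 sB uX0.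
apply: (limit_type_not_simple sl Ms Mh O dlt0 Ss mono sh wom cX0 sB uB dSB dX0B).
have cq := limit_type_complete Ms O Ss cX0 sB uB.
pose q := limit_type lt S a X0 (B := B).
have s0 : (set0 : set M) `<=` B by [].
(* The hereditary clause for the restriction of [q] to the empty set applies to [q]. *)
pose p : set (formulaA (set0 : set M) 1) := [set phi | q (liftA s0 phi)].
apply: (simple p _ B s0 q) => //.
split=> [r rp _|phi]; last by case: cq => _ /(_ (liftA s0 phi)).
have [x Dx] := limit_nonempty Ms O Ss cX0 sB.
exists (fun=> x) => phi /rp.
rewrite /p /= => /(Dx _ (dfn1_fdef _)); rewrite /fdef /satA /= /liftA sat_rename.
match goal with |- sat ?f _ -> sat ?g _ => suff -> : f = g by [] end.
by apply/funext => -[].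
Qed.

Theorem theorem3p7 (K : Type) (L : signature) (T : set (sentence L))
    (M : structure L) (lt : M -> M -> Prop) :
  complete_theory T ->
  monster K T M ->
  weakly_quasi_o_minimal M ->
  zero_definable_order lt ->
  (~ theory_simple_semiintervals K M -> admits_shift lt) /\
  (small_theory M \/ weakly_o_minimal M ->
   admits_shift lt -> ~ theory_simple_semiintervals K M).
Proof.
move=> _ [_ sl Ms Mh] wq [O /definable2P dlt0]; split; last first.
  exact: shift_not_simple.
move=> ns; apply: contrapT => na; apply: ns.
apply: (noshift_simple sl Ms Mh O dlt0) => S A Ss dS a sh.
apply: na; exists S; split; last by exists a.
by split=> [x|x|]; [case: (Ss x)|case: (Ss x)|exists A; apply/definable2P].
Qed.
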